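(* Let $n\ge 1$ and $r\geq 1$. Let $f:\mathbb{T}^{2n}\rightarrow\mathbb{T}^{2n}$ be an Anosov symplectic $C^r$ diffeomorphism, let $\gamma\in C^r(\mathbb{T}^{2n};\mathbb{S}^1)$ be a coboundary with respect to $f$, and let $F:\mathbb{T}^{2n}\times\mathbb{S}^1\rightarrow\mathbb{T}^{2n}\times\mathbb{S}^1$ be the skew-product $F(p,t)=(f(p),t+\gamma(p))$. Then $F$ is not a partially hyperbolic contact $C^r$ diffeomorphism; that is, there are no partially hyperbolic contact $C^r$ skew-products of this form.
   Context: $\mathbb{S}^1=\mathbb{R}/\mathbb{Z}$, written additively. A diffeomorphism is symplectic if it preserves a symplectic form. Coboundary: $\gamma\in C^r(M;\mathbb{S}^1)$ is a coboundary with respect to (relative to) a diffeomorphism $f:M\to M$ if there is $\mu\in C^\ell(M;\mathbb{S}^1)$, for some $\ell\le r$, with $\gamma=\mu\circ f-\mu$; $\mu$ is called the transfer map. Partially hyperbolic: a diffeomorphism $F:N\to N$ is partially hyperbolic if there is a splitting $TN=E^s\oplus E^c\oplus E^u$ such that (i) $DF(E^\delta)=E^\delta$ for $\delta=s,c,u$; (ii) there are constants $C>0$ and $0<\lambda<1$ with $\|DF^n_p v_s\|\le C\lambda^n\|v_s\|$ and $\|DF_p^{-n}v_u\|\le C\lambda^n\|v_u\|$ for all $p\in N$, $v_s\in E^s_p$, $v_u\in E^u_p$ (and $n\ge 0$); (iii) there are real numbers $0<\mu_1<1<\mu_2$ (possibly depending on $p$) with $\|DF_p|_{E^s_p}\|<\mu_1<\|DF_p|_{E^c_p}\|<\mu_2<\|DF_p|_{E^u_p}\|$.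 Contact form: on a manifold $N$ of dimension $2n+1$, a globally defined differential $1$-form $\alpha$ with $\alpha\wedge(d\alpha)^n\neq 0$ at every point. Partially hyperbolic contact $C^r$ diffeomorphism: a partially hyperbolic $C^r$ diffeomorphism $F:N\to N$ for which there are a contact form $\alpha$ on $N$ and a $C^\infty$ function $\tau:N\to(0,+\infty)$ with $F^\ast\alpha=\tau\alpha$. *)

(* Defs.v *)
From HB Require Import structures.
From mathcomp Require Import all_boot all_order all_algebra all_fingroup.
From mathcomp Require Import generic_quotient ring_quotient.
From mathcomp Require Import all_classical all_reals all_analysis.

Set Implicit Arguments.
Unset Strict Implicit.
Unset Printing Implicit Defensive.

Import Order.TTheory GRing.Theory Num.Theory.
Import numFieldNormedType.Exports.

Local Open Scope classical_set_scope.
Local Open Scope ring_scope.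
Local Open Scope quotient_scope.

(* ** Tori *)

Definition lattice (R : realType) (m : nat) : {pred 'rV[R]_m} :=
  fun x => x \is a mxOver Num.int.

Fact lattice_zmod_closed (R : realType) (m : nat) :
  zmod_closed (@lattice R m).
Proof.
split=> [|x y hx hy]; first by apply/mxOverP => i j; rewrite mxE rpred0.
apply/mxOverP => i j; rewrite !mxE rpredB //.
  by have /mxOverP := hx; exact.
by have /mxOverP := hy; exact.
Qed.

HB.instance Definition _ (R : realType) (m : nat) :=
  GRing.isZmodClosed.Build 'rV[R]_m (@lattice R m) (@lattice_zmod_closed R m).

Definition torus (R : realType) (m : nat) : Type :=
  @Quotient.quot 'rV[R]_m (@lattice R m).

HB.instance Definition _ (R : realType) (m : nat) :=
  GRing.Zmodule.on (torus R m).

(* R/Z, as the one-dimensional torus; its group law is the one of torus. *)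
Notation circle R := (torus R 1).

Definition torus_proj (R : realType) (m : nat) : 'rV[R]_m -> torus R m :=
  fun x => \pi_(@Quotient.quot 'rV[R]_m (@lattice R m)) x.

(* A manifold presented as R^m/Z^m through its universal covering tor_proj.
   The deck transformations are the translations by integer vectors, so that
   tor_proj trivialises the tangent bundle: tangent vectors at every point are
   elements of 'rV_m, subbundles are families of row spaces and tensor fields
   are functions on the manifold. This covers the tori and their products. *)
Record toral (R : realType) := Toral {
  tor_sort :> Type;
  tor_dim : nat;
  tor_proj : 'rV[R]_tor_dim -> tor_sort;
  tor_projE : forall x y,
    tor_proj x = tor_proj y <-> x - y \is a mxOver Num.int;
  tor_surj : forall p, exists x, tor_proj x = p }.
Arguments tor_proj {R} t x.

Lemma torus_projE (R : realType) (m : nat) (x y : 'rV[R]_m) :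
  torus_proj x = torus_proj y <-> x - y \is a mxOver Num.int.
Proof.
rewrite -[x - y \is a _]/(x - y \in @lattice R m).
by rewrite Quotient.idealrBE; split=> [h|/eqP h //]; apply/eqP.
Qed.

Lemma torus_surj (R : realType) (m : nat) (p : torus R m) :
  exists x, torus_proj x = p.
Proof.
by exists (repr (p : @Quotient.quot 'rV[R]_m (@lattice R m)));
  exact: reprK.
Qed.

Canonical torus_toral (R : realType) (m : nat) : toral R :=
  Toral (@torus_projE R m) (@torus_surj R m).

Section Product.
Context (R : realType) (M N : toral R).

Definition prod_proj (x : 'rV[R]_(tor_dim M + tor_dim N)) : M * N :=
  (tor_proj M (lsubmx x), tor_proj N (rsubmx x)).

Lemma prod_projE x y :
  prod_proj x = prod_proj y <-> x - y \is a mxOver Num.int.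
Proof.
split.
  move=> [/tor_projE /mxOverP h1 /tor_projE /mxOverP h2].
  apply/mxOverP => i j; rewrite !mxE; case: (split_ordP j) => k ->.
    by have := h1 i k; rewrite !mxE.
  by have := h2 i k; rewrite !mxE.
move=> /mxOverP h; congr (_, _); apply/tor_projE/mxOverP => i j; rewrite !mxE.
  by have := h i (lshift _ j); rewrite !mxE.
by have := h i (rshift _ j); rewrite !mxE.
Qed.

Lemma prod_surj p : exists x, prod_proj x = p.
Proof.
case: p => p q; have [x <-] := tor_surj p; have [y <-] := tor_surj q.
by exists (row_mx x y); rewrite /prod_proj row_mxKl row_mxKr.
Qed.

Canonical prod_toral : toral R := Toral prod_projE prod_surj.

End Product.

(* ** Differentiability classes *)

Fixpoint Ck (R : realType) (U V : normedModType R) (k : nat) (g : U -> V)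
  : Prop :=
  if k is k'.+1 then
    (forall x, differentiable g x) /\ forall v, Ck k' (fun x => 'D_v g x)
  else continuous g.

(* Orders of differentiability in nat + infinity, None being infinity. *)
Definition regularity := option nat.

Definition reg_le (l r : regularity) : bool :=
  if r isn't Some r' then true else
  if l is Some l' then (l' <= r')%N else false.

Section Calculus.
Context (R : realType).
Implicit Types M N : toral R.

Definition is_lift M N (f : M -> N) (G : 'rV[R]_(tor_dim M) -> 'rV_(tor_dim N))
  : Prop :=
  forall x, f (tor_proj M x) = tor_proj N (G x).

(* R^m is simply connected: a map of class C^r between toral manifolds is one
   which is covered by a map of class C^r between the universal coverings. *)
Definition Cr (r : regularity) M N (f : M -> N) : Prop :=
  exists2 G, is_lift f G & forall k, reg_le (Some k) r -> Ck k G.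

Definition smooth M (h : M -> R) : Prop :=
  forall k, Ck k (fun x => h (tor_proj M x) : R^o).

Definition diffeo (r : regularity) M (f : M -> M) : Prop :=
  exists finv, [/\ cancel f finv, cancel finv f, Cr r f & Cr r finv].

Definition base_pt M (p : M) : 'rV[R]_(tor_dim M) :=
  get [set x | tor_proj M x = p].

Definition C1_lift M N (f : M -> N) : 'rV[R]_(tor_dim M) -> 'rV_(tor_dim N) :=
  get [set G | is_lift f G /\ Ck 1 G].

(* Df_p acts on row vectors by right multiplication. Two C^1 lifts of f differ
   by a constant, and translating the base point by an integer vector does not
   change the Jacobian, so no choice matters when f is of class C^1. *)
Definition tangent M N (f : M -> N) (p : M) : 'M[R]_(tor_dim M, tor_dim N) :=
  jacobian (C1_lift f) (base_pt p).

(* ** Differential forms *)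

(* A k-form at a point takes the k x m matrix whose rows are its arguments. *)
Definition multilinear k m (a : 'M[R]_(k, m) -> R) : Prop :=
  forall (A B C : 'M[R]_(k, m)) i b c,
    row i A = b *: row i B + c *: row i C ->
    row' i B = row' i A -> row' i C = row' i A -> a A = b * a B + c * a C.

Definition alternating k m (a : 'M[R]_(k, m) -> R) : Prop :=
  forall A i j, i != j -> row i A = row j A -> a A = 0.

Definition diff_form k M (w : M -> 'M[R]_(k, tor_dim M) -> R) : Prop :=
  [/\ forall p, multilinear (w p), forall p, alternating (w p) &
      forall A, smooth (fun p => w p A)].

Definition wedge p q m (a : 'M[R]_(p, m) -> R) (b : 'M[R]_(q, m) -> R)
    (A : 'M[R]_(p + q, m)) : R :=
  (p`! * q`!)%:R^-1 *
  \sum_(s : 'S_(p + q))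
    (-1) ^+ s * a (usubmx (row_perm s A)) * b (dsubmx (row_perm s A)).

Fixpoint wedge_exp m (b : 'M[R]_(2, m) -> R) n : 'M[R]_(n * 2, m) -> R :=
  if n is n'.+1 then wedge b (@wedge_exp m b n') else fun=> 1.
Arguments wedge_exp {m} b n A.

(* The rows of A extend to constant, hence commuting, vector fields, so the
   bracket terms of the invariant formula for the derivative vanish. *)
Definition ext_d k M (w : M -> 'M[R]_(k, tor_dim M) -> R) (p : M)
    (A : 'M[R]_(k.+1, tor_dim M)) : R :=
  \sum_(i < k.+1) (-1) ^+ i *
    'D_(row i A) (fun x => w (tor_proj M x) (row' i A) : R^o) (base_pt p).

Definition pullback k M N (f : M -> N) (w : N -> 'M[R]_(k, tor_dim N) -> R)
    (p : M) (A : 'M[R]_(k, tor_dim M)) : R :=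
  w (f p) (A *m tangent f p).

Definition symplectic_form M (w : M -> 'M[R]_(2, tor_dim M) -> R) : Prop :=
  [/\ diff_form w, forall p A, ext_d w p A = 0 &
      forall p (u : 'rV[R]_(tor_dim M)), u != 0 ->
        exists v : 'rV[R]_(tor_dim M), w p (col_mx u v) != 0].

Definition symplectic M (f : M -> M) : Prop :=
  exists2 w, symplectic_form w & forall p A, pullback f w p A = w p A.

Definition contact_form M (a : M -> 'M[R]_(1, tor_dim M) -> R) : Prop :=
  diff_form a /\
  exists2 n, tor_dim M = (2 * n + 1)%N &
    forall p, exists A, wedge (a p) (wedge_exp (ext_d a p) n) A != 0.

(* ** Hyperbolicity *)

Definition riemannian M (g : M -> 'M[R]_(tor_dim M)) : Prop :=
  [/\ forall p, (g p)^T = g p,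
      forall p (v : 'rV[R]_(tor_dim M)), v != 0 -> 0 < (v *m g p *m v^T) 0 0 &
      forall i j, smooth (fun p => g p i j)].

Definition rnorm M (g : M -> 'M[R]_(tor_dim M)) (p : M)
    (v : 'rV[R]_(tor_dim M)) : R :=
  Num.sqrt ((v *m g p *m v^T) 0 0).

(* Operator norm of the restriction of Df_p to the row space of E p. *)
Definition opnorm M (g : M -> 'M[R]_(tor_dim M)) (f : M -> M)
    (E : M -> 'M[R]_(tor_dim M)) (p : M) : R :=
  sup [set rnorm g (f p) (v *m tangent f p) |
       v in [set v | (v <= E p)%MS /\ rnorm g p v <= 1]].

Definition invariant_bundle M (f : M -> M) (E : M -> 'M[R]_(tor_dim M))
  : Prop :=
  forall p, (E p *m tangent f p == E (f p))%MS.

Definition contracts M (g : M -> 'M[R]_(tor_dim M)) (f : M -> M)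
    (E : M -> 'M[R]_(tor_dim M)) (C lambda : R) : Prop :=
  forall p (v : 'rV[R]_(tor_dim M)) n, (v <= E p)%MS ->
    rnorm g (iter n f p) (v *m tangent (iter n f) p)
      <= C * lambda ^+ n * rnorm g p v.

Definition anosov M (f : M -> M) : Prop :=
  exists finv g Es Eu,
    [/\ cancel f finv /\ cancel finv f,
        riemannian g,
        forall p, row_full (Es p + Eu p)%MS /\ mxdirect (Es p + Eu p),
        invariant_bundle f Es /\ invariant_bundle f Eu &
        exists C lambda : R,
          [/\ 0 < C, 0 < lambda < 1, contracts g f Es C lambda &
              contracts g finv Eu C lambda]].

Definition partially_hyperbolic M (f : M -> M) : Prop :=
  exists finv g Es Ec Eu,
    [/\ (cancel f finv /\ cancel finv f) /\ riemannian g,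
        forall p, row_full (Es p + Ec p + Eu p)%MS
                  /\ mxdirect (Es p + Ec p + Eu p),
        [/\ invariant_bundle f Es, invariant_bundle f Ec &
            invariant_bundle f Eu],
        exists C lambda : R,
          [/\ 0 < C, 0 < lambda < 1, contracts g f Es C lambda &
              contracts g finv Eu C lambda] &
        forall p, exists mu1 mu2 : R,
          [/\ 0 < mu1 < 1, 1 < mu2, opnorm g f Es p < mu1,
              mu1 < opnorm g f Ec p < mu2 & mu2 < opnorm g f Eu p]].

Definition ph_contact (r : regularity) M (f : M -> M) : Prop :=
  [/\ diffeo r f, partially_hyperbolic f &
      exists (a : M -> 'M[R]_(1, tor_dim M) -> R) (tau : M -> R),
        [/\ contact_form a, smooth tau, forall p, 0 < tau p &
            forall p A, pullback f a p A = tau p * a p A]].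

(* ** Skew-products *)

Definition coboundary (r : regularity) M (f : M -> M) (gamma : M -> circle R)
  : Prop :=
  exists2 l, reg_le l r &
    exists2 mu : M -> circle R, Cr l mu &
      forall p, gamma p = mu (f p) - mu p.

Definition skew_product M (f : M -> M) (gamma : M -> circle R)
    (q : M * circle R) : M * circle R :=
  (f q.1, q.2 + gamma q.1).

End Calculus.

(* Main.v *)
(* Let F^* a = tau a with a a contact form. Comparing the volume a /\ da^n with
   w^n /\ dt, where w is the symplectic form preserved by f, shows that tau is a
   coboundary up to a power, so a rescaling of a by a bounded function is
   F-invariant. Where a(d/dt) vanishes, a is an invariant bounded covector on
   the base and hyperbolicity of f makes it vanish on the stable and unstable
   bundles; so a(d/dt) has no zero and b = a / a(d/dt) is an F-invariant smooth
   form dt + lam. The difference of b and one of its translates along the circle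
   is again an invariant covector on the base, hence zero, so lam lives on the
   base, where d lam is nondegenerate by the contact condition. But an exact
   2-form on a torus degenerates somewhere, since its Liouville field would have
   positive divergence with respect to the induced volume. *)
Require Import Defs.
From mathcomp Require Import all_boot all_order all_algebra.
From mathcomp Require Import all_fingroup generic_quotient ring_quotient.
From mathcomp Require Import all_classical all_reals all_analysis.
From mathcomp Require Import ring lra.

Set Implicit Arguments.
Unset Strict Implicit.
Unset Printing Implicit Defensive.

Import Order.TTheory GRing.Theory Num.Theory.
Import numFieldNormedType.Exports.

Local Open Scope classical_set_scope.
Local Open Scope ring_scope.

(** * Functions of class C^k *)

(** Two obstacles shape the proof. Since [r] may be 1, the derivative of [F] may be merely
    continuous, so d([F]^* a) = [F]^* da cannot be computed from second derivatives of [F]. It still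
    holds pointwise because [F]^* a = tau a is known to be smooth; the proof applies Schwarz's
    theorem to a quadratic primitive built at each point. The second obstacle is tau: as long as it
    is not 1, a satisfies no invariance to which contraction could be applied. On the product, of
    dimension 2n + 1, a /\ da^n is multiplied by tau^(n + 1) under [F]^*, while w^n /\ dt is
    preserved. Squares of these densities are determinants, whose quotient k satisfies k(F p)
    tau(p)^(2n + 2) = k(p). Hence k times the power 2n + 2 of a covector that is scaled by tau is
    exactly invariant: neither a root nor a sign has to be chosen, and boundedness of k and of the
    covector is enough for the contraction argument. *)

Section CkTheory.
Context {R : realType} {U : normedModType R}.

Lemma Ck_continuous (W : normedModType R) k (g : U -> W) : Ck k g -> continuous g.
Proof.
by case: k => [//|k] [dg _] x; exact: differentiable_continuous (dg x).
Qed.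

Lemma CkW (W : normedModType R) k l (g : U -> W) : (l <= k)%N -> Ck k g -> Ck l g.
Proof.
elim: k l g => [|k IH] [|l] g // lk Cg; first exact: Ck_continuous Cg.
case: Cg => dg Dg; split=> [|v]; [exact: dg|exact: IH (Dg v)].
Qed.

Lemma Ck_cst (W : normedModType R) k (c : W) : Ck k (fun _ : U => c).
Proof.
elim: k c => [|k IH] c; first exact: cst_continuous.
split=> [x|v]; first exact: differentiable_cst.
rewrite [X in Ck _ X](_ : _ = fun=> 0); first exact: IH.
by apply/funext => x; rewrite derive_cst.
Qed.

Lemma CkD (W : normedModType R) k (f g : U -> W) :
  Ck k f -> Ck k g -> Ck k (fun x => f x + g x).
Proof.
elim: k f g => [|k IH] f g /=.
  by move=> cf cg x; apply: cvgD; [exact: cf|exact: cg].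
move=> [df Df] [dg Dg]; split=> [x|v]; first exact: differentiableD.
rewrite [X in Ck _ X](_ : _ = fun x => 'D_v f x + 'D_v g x); first exact: IH.
by apply/funext => x; apply: deriveD; exact: diff_derivable.
Qed.

Lemma CkZ (W : normedModType R) k (c : R) (f : U -> W) :
  Ck k f -> Ck k (fun x => c *: f x).
Proof.
elim: k f => [|k IH] f /=.
  by move=> cf x; apply: cvgZr; exact: cf.
move=> [df Df]; split=> [x|v]; first exact: differentiableZ.
rewrite [X in Ck _ X](_ : _ = fun x => c *: 'D_v f x); first exact: IH.
by apply/funext => x; apply: deriveZ; exact: diff_derivable.
Qed.

Lemma CkN (W : normedModType R) k (f : U -> W) :
  Ck k f -> Ck k (fun x => - f x).
Proof. by under eq_fun do rewrite -scaleN1r; exact: CkZ. Qed.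

Lemma CkB (W : normedModType R) k (f g : U -> W) :
  Ck k f -> Ck k g -> Ck k (fun x => f x - g x).
Proof. by move=> Cf Cg; apply: CkD => //; exact: CkN. Qed.

Lemma CkM k (f g : U -> R^o) :
  Ck k f -> Ck k g -> Ck k (fun x => f x * g x : R^o).
Proof.
elim: k f g => [|k IH] f g.
  by move=> cf cg x; apply: cvgM; [exact: cf|exact: cg].
move=> Cf Cg; have [df Df] := Cf; have [dg Dg] := Cg.
split=> [x|v]; first exact: differentiableM.
rewrite [X in Ck _ X](_ : _ = fun x => f x * 'D_v g x + g x * 'D_v f x : R^o).
  by apply: CkD; apply: IH; [exact: CkW (leqnSn k) Cf|exact: Dg
                            |exact: CkW (leqnSn k) Cg|exact: Df].
by apply/funext => x; apply: deriveM; exact: diff_derivable.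
Qed.

Lemma CkV k (f : U -> R^o) :
  (forall x, f x != 0) -> Ck k f -> Ck k (fun x => (f x)^-1 : R^o).
Proof.
move=> f0; elim: k => [|k IH] Cf; first by move=> x; apply: cvgV => //; exact: Cf.
have [df Df] := Cf; split=> [x|v]; first exact: differentiableV.
rewrite [X in Ck _ X](_ : _ = fun x => - ((f x)^-1 * (f x)^-1 * 'D_v f x) : R^o).
  have Ck1 := IH (CkW (leqnSn k) Cf).
  by apply: CkN; apply: CkM; [exact: CkM|exact: Df].
apply/funext => x; rewrite deriveV //; last exact: diff_derivable.
by rewrite scaleNr expr2 invfM.
Qed.

Lemma Ck_sum (W : normedModType R) (I : Type) (r : seq I) (P : pred I) k
    (F : I -> U -> W) :
  (forall i, P i -> Ck k (F i)) -> Ck k (fun x => \sum_(i <- r | P i) F i x).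
Proof.
move=> CF; elim: r => [|i r IH].
  rewrite [X in Ck _ X](_ : _ = fun=> 0); first exact: Ck_cst.
  by apply/funext => x; rewrite big_nil.
have [Pi|Pi] := boolP (P i).
  rewrite [X in Ck _ X](_ : _ = fun x => F i x + \sum_(i <- r | P i) F i x).
    by apply: CkD => //; exact: CF.
  by apply/funext => x; rewrite big_cons Pi.
rewrite [X in Ck _ X](_ : _ = fun x => \sum_(i <- r | P i) F i x) //.
by apply/funext => x; rewrite big_cons (negPf Pi).
Qed.

Lemma Ck_prod (I : Type) (r : seq I) (P : pred I) k (F : I -> U -> R^o) :
  (forall i, P i -> Ck k (F i)) ->
  Ck k (fun x => \prod_(i <- r | P i) F i x : R^o).
Proof.
move=> CF; elim: r => [|i r IH].
  rewrite [X in Ck _ X](_ : _ = fun=> 1); first exact: Ck_cst.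
  by apply/funext => x; rewrite big_nil.
have [Pi|Pi] := boolP (P i).
  rewrite [X in Ck _ X](_ : _ = fun x => F i x * \prod_(i <- r | P i) F i x : R^o).
    by apply: CkM => //; exact: CF.
  by apply/funext => x; rewrite big_cons Pi.
rewrite [X in Ck _ X](_ : _ = fun x => \prod_(i <- r | P i) F i x : R^o) //.
by apply/funext => x; rewrite big_cons (negPf Pi).
Qed.

Lemma Ck_det k n (M : U -> 'M[R]_n) :
  (forall i j, Ck k (fun x => M x i j : R^o)) -> Ck k (fun x => \det (M x) : R^o).
Proof.
move=> CM; apply: Ck_sum => s _; apply: CkM; first exact: Ck_cst.
exact: Ck_prod.
Qed.

Lemma Ck_invmx k n (M : U -> 'M[R]_n) :
  (forall x, \det (M x) != 0) -> (forall i j, Ck k (fun x => M x i j : R^o)) ->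
  forall i j, Ck k (fun x => invmx (M x) i j : R^o).
Proof.
move=> dM CM i j.
rewrite [X in Ck _ X](_ : _ = fun x => (\det (M x))^-1 * cofactor (M x) j i : R^o).
  apply: CkM; first by apply: CkV => //; exact: Ck_det.
  apply: CkM; first exact: Ck_cst.
  by apply: Ck_det => a b; under eq_fun do rewrite !mxE; exact: CM.
apply/funext => x; rewrite /invmx unitmxE unitfE dM !mxE //.
Qed.

Lemma Ck1_sqrt (f : U -> R^o) :
  (forall x, 0 < f x) -> Ck 1 f -> Ck 1 (fun x => Num.sqrt (f x) : R^o).
Proof.
move=> f0 [df Df].
have cs : continuous (fun x => Num.sqrt (f x) : R^o).
  move=> x; apply: continuous_comp; last exact: sqrt_continuous.
  exact: differentiable_continuous.
have ds x : differentiable (Num.sqrt : R^o -> R^o) (f x).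
  by apply/derivable1_diffP; have := is_derive1_sqrt (f0 x).
split=> [x|v]; first exact: differentiable_comp.
rewrite [X in Ck _ X](_ : _ = fun x => (2 * Num.sqrt (f x))^-1 * 'D_v f x : R^o).
  apply: (@CkM 0); last exact: Df.
  apply: (@CkV 0); first by move=> x; rewrite mulf_neq0 // gt_eqF // sqrtr_gt0.
  by apply: (@CkM 0) => //; exact: (@Ck_cst _ 0).
apply/funext => x; rewrite deriveE; last exact: differentiable_comp.
rewrite diff_comp // /= -(deriveE v (df x)).
transitivity ('D_v f x *: Num.sqrt^`()%classic (f x) : R^o).
  exact: (congr1 (fun g => g ('D_v f x)) (diff1E (ds x))).
by rewrite derive1E derive_sqrt // [RHS]mulrC.
Qed.

End CkTheory.

(** * Schwarz's theorem *)

Section Schwarz.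
Context {R : realType} {V : normedModType R}.
Implicit Types (f : V -> R^o) (u v x y : V).

Lemma is_derive_line (W : normedModType R) (f : V -> W) u y (s : R) :
  derivable f (s *: u + y) u ->
  is_derive s 1 (fun t : R^o => f (t *: u + y)) ('D_u f (s *: u + y)).
Proof.
move=> df.
have E : (fun h : R^o => h^-1 *: (((fun t : R^o => f (t *: u + y)) \o shift s)
    (h *: (1 : R^o)) - f (s *: u + y))) =
  (fun h => h^-1 *: ((f \o shift (s *: u + y)) (h *: u) - f (s *: u + y))).
  apply/funext => h /=; congr (_ *: (f _ - _)).
  by rewrite scalerDl addrA -[(h *: 1)]/(h * 1) mulr1.
apply: DeriveDef; first by rewrite /derivable E.
by rewrite /derive E.
Qed.

Lemma diff_eps (W : normedModType R) (g : V -> W) x (e : R) :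
  differentiable g x -> 0 < e ->
  exists2 d : R, 0 < d & forall w, `|w| < d ->
    `|g (w + x) - g x - 'd g x w| <= e * `|w|.
Proof.
move=> dg e0; have [K _] := eqaddoP (nbhs (0 : V)) (g \o shift x) (cst (g x) + 'd g x) id.
have /nbhs_normP[d /= d0 H] := K (diff_locally dg) e e0.
exists d => // w wd.
have := H w; rewrite /= sub0r normrN => /(_ wd).
by rewrite !fctE /= opprD addrA.
Qed.

Let S f x u v (h : R) := f (h *: u + (h *: v + x)) - f (h *: u + x)
  - (f (h *: v + x) - f x).

(** The mean value theorem for t |-> f(t u + h v + x) - f(t u + x) turns the second difference into
    [h] times a difference of two values of 'D_u f, which its differentiability at the single point
    [x] then expands. *)
Lemma second_difference f x u v (e : R) :
  (forall y, derivable f y u) -> differentiable ('D_u f : V -> R^o) x -> 0 < e ->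
  exists2 d : R, 0 < d & forall h, 0 < h < d ->
    `|S f x u v h - h ^+ 2 * 'D_v ('D_u f : V -> R^o) x| <= e * h ^+ 2.
Proof.
move=> fu dg e0; set g := ('D_u f : V -> R^o).
(* The two expansions are taken at vectors of norm at most h(|u| + |v|) and h|u|, so their errors
   add up to at most (e / c) h (c - 1); the 1 keeps [c] positive. *)
rewrite -/g in dg *; set c := `|u| + `|v| + `|u| + 1.
have c0 : 0 < c by rewrite ltr_wpDl // !addr_ge0.
have [d d0 Hd] := diff_eps dg (divr_gt0 e0 c0).
exists (d / c) => [|h /andP[h0 hd]]; first exact: divr_gt0.
have [xi] : exists2 xi, xi \in `]0, h[ &
    S f x u v h = (g (xi *: u + (h *: v + x)) - g (xi *: u + x)) * h.
  have D (s : R) : is_derive s (1 : R) (fun t : R => f (t *: u + (h *: v + x))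
      - f (t *: u + x) : R^o) (g (s *: u + (h *: v + x)) - g (s *: u + x)).
    by apply: is_deriveB; exact: is_derive_line.
  have [|xi hxi E] := MVT h0 (fun s _ => D s).
    apply: continuous_subspaceT => s; apply: differentiable_continuous.
    by apply/derivable1_diffP; have [] := D s.
  exists xi => //.
  by rewrite -[X in _ = _ * X]subr0 -E /S !scale0r !add0r.
rewrite in_itv /= => /andP[xi0 xih] ->.
have n1 : `|xi *: u| <= h * `|u|.
  by rewrite normrZ gtr0_norm // ler_wpM2r // ltW.
have n2 : `|xi *: u + h *: v| <= h * `|u| + h * `|v|.
  by rewrite (le_trans (ler_normD _ _)) // lerD // normrZ gtr0_norm.
have hc : h * c < d by rewrite -ltr_pdivlMr.
have b1 := Hd (xi *: u + h *: v); have b2 := Hd (xi *: u).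
have : `|xi *: u + h *: v| < d.
  apply: le_lt_trans n2 (le_lt_trans _ hc); rewrite -mulrDr ler_pM2l // /c.
  by rewrite -addrA lerDl addr_ge0.
move=> /b1 {}b1.
have : `|xi *: u| < d.
  apply: le_lt_trans n1 (le_lt_trans _ hc); rewrite ler_pM2l // /c.
  by rewrite -!addrA lerDl !addr_ge0.
move=> /b2 {}b2; rewrite addrA.
have ec0 : 0 <= e / c by rewrite divr_ge0 // ltW.
have dE : 'd g x (xi *: u + h *: v) = 'd g x (xi *: u) + h * 'D_v g x.
  rewrite linearD; congr (_ + _); rewrite linearZ /=.
  exact: (congr1 ( *%R h) (esym (deriveE v dg))).
move: (ler_wpM2l ec0 n1) (ler_wpM2l ec0 n2) => m1 m2.
have {b1 m2} B1 := le_trans b1 m2; have {b2 m1} B2 := le_trans b2 m1.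
rewrite dE in B1.
have -> : (g (xi *: u + h *: v + x) - g (xi *: u + x)) * h - h ^+ 2 * 'D_v g x =
  h * ((g (xi *: u + h *: v + x) - g x - ('d g x (xi *: u) + h * 'D_v g x))
       - (g (xi *: u + x) - g x - 'd g x (xi *: u))) by ring.
rewrite normrM gtr0_norm // [e * _]mulrC expr2 -mulrA ler_pM2l //.
apply: le_trans (ler_normB _ _) (le_trans (lerD B1 B2) _).
have -> : e / c * (h * `|u| + h * `|v|) + e / c * (h * `|u|) =
  h * (e / c * (c - 1)) by rewrite /c; ring.
rewrite ler_pM2l // mulrBr mulr1 divfK ?gt_eqF // gerBl //.
Qed.

(* Schwarz's theorem under the sole assumption that the two first derivatives
   are differentiable at x, which is what makes exterior_chain available for
   maps that are only of class C^1. *)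
Lemma derive_sym f x u v :
  (forall y, derivable f y u) -> (forall y, derivable f y v) ->
  differentiable ('D_u f : V -> R^o) x -> differentiable ('D_v f : V -> R^o) x ->
  'D_v ('D_u f : V -> R^o) x = 'D_u ('D_v f : V -> R^o) x.
Proof.
move=> fu fv du dv; apply/eqP; rewrite -subr_eq0 -normr_le0.
apply/ler_addgt0Pl => e e0; rewrite addr0.
have e2 : 0 < e / 2 by rewrite divr_gt0.
have [d1 d10 H1] := second_difference v fu du e2.
have [d2 d20 H2] := second_difference u fv dv e2.
set h := Num.min d1 d2 / 2.
have m0 : 0 < Num.min d1 d2 by rewrite lt_min d10.
have h0 : 0 < h by rewrite divr_gt0.
have hm : h < Num.min d1 d2 by rewrite /h ltr_pdivrMr // ltr_pMr // ltr1n.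
move: hm; rewrite lt_min => /andP[hd1 hd2].
have {}H1 := H1 h; rewrite h0 hd1 in H1; have {}H1 := H1 isT.
have {}H2 := H2 h; rewrite h0 hd2 in H2; have {}H2 := H2 isT.
have SE : S f x v u h = S f x u v h.
  rewrite /S (addrCA (h *: v)).
  by ring.
rewrite SE in H2.
have := le_trans (ler_normB _ _) (lerD H2 H1).
set a := 'D_v _ x; set b := 'D_u _ x.
have -> : S f x u v h - h ^+ 2 * b - (S f x u v h - h ^+ 2 * a) = h ^+ 2 * (a - b).
  by ring.
rewrite normrM ger0_norm ?sqr_ge0 // -mulrDl -splitr mulrC.
by rewrite ler_pM2r // exprn_gt0.
Qed.

End Schwarz.

(** * Exterior derivative and C^1 maps *)

Section PullbackD.
Context {R : realType} {U : normedModType R}.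
Implicit Types (x u v w : U).

(** Write f c = c(x) f + f (c - c(x)): near [x] the first factor of the last product is of the order
    of the displacement and the second tends to 0, so that this product has zero differential. This
    is how products involving a merely continuous derivative of a C^1 map get differentiated. *)
Lemma diffM_vanishing (f c : U -> R^o) x :
  differentiable f x -> f x = 0 -> {for x, continuous c} ->
  differentiable (fun y => f y * c y : R^o) x /\
  forall w, 'D_w (fun y => f y * c y : R^o) x = 'D_w f x * c x.
Proof.
move=> df f0 cc.
pose r := fun y => f y * (c y - c x) : R^o.
pose z : {linear U -> R^o} := \0.
have ro : r \o shift x = cst (r x) + z +o_ (0 : U) id.
  apply/eqaddoP => e e0.
  have [k k0 kP] := linear_lipschitz (diff_continuous df).
  have [d d0 dP] := diff_eps df (ltr01).
  have k1 : 0 < k + 1 by rewrite addr_gt0.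
  have /cvgrPdist_le cc' := cc.
  have /nbhs_normP[d' /= d'0 d'P] := cc' _ (divr_gt0 e0 k1).
  apply/nbhs_normP; exists (Num.min d d'); first by rewrite /= lt_min d0.
  move=> h /=; rewrite sub0r normrN lt_min => /andP[hd hd'].
  rewrite !fctE /= /r f0 mul0r addr0 subr0 normrM.
  have fh : `|f (h + x)| <= (k + 1) * `|h|.
    have := dP _ hd; rewrite f0 subr0 mul1r => fh1.
    rewrite mulrDl mul1r -[f _](subrK ('d f x h)) addrC.
    by rewrite (le_trans (ler_normD _ _)) // lerD.
  have ch : `|c (h + x) - c x| <= e / (k + 1).
    by rewrite distrC; apply: d'P; rewrite /= opprD addrCA subrr addr0 normrN.
  apply: le_trans (ler_pM _ _ fh ch) _ => //.
  by rewrite mulrAC mulrCA mulfV ?gt_eqF // mulr1.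
have cz : continuous z by exact: (@cst_continuous U R^o 0).
have r0 := diff_unique cz ro.
have dr : differentiable r x.
  by apply/diff_locallyP; rewrite r0.
have E : (fun y => f y * c y : R^o) = (fun y => r y + c x *: f y : R^o).
  by apply/funext => y; rewrite /r mulrBr [c x *: _]mulrC subrK.
rewrite E; split => [|w]; first by apply: differentiableD => //; exact: differentiableZ.
rewrite (deriveD (f := r) (g := c x \*: f)); last 2 first.
- exact: diff_derivable.
- by apply: diff_derivable; exact: differentiableZ.
rewrite deriveZ; last exact: diff_derivable.
by rewrite deriveE // r0 add0r [RHS]mulrC.
Qed.

Lemma is_derive_bigsum (W : normedModType R) (I : Type) (r : seq I) (P : pred I)
    (F : I -> U -> W) (D : I -> W) x v :
  (forall i, P i -> is_derive x v (F i) (D i)) ->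
  is_derive x v (fun y => \sum_(i <- r | P i) F i y) (\sum_(i <- r | P i) D i).
Proof.
move=> FD; elim: r => [|i r IH].
  rewrite big_nil [X in is_derive _ _ X](_ : _ = cst 0); first exact: is_derive_cst.
  by apply/funext => y; rewrite big_nil.
rewrite [X in is_derive _ _ X](_ : _ = fun y => (if P i then F i y else 0) +
    \sum_(i <- r | P i) F i y); last first.
  by apply/funext => y; rewrite big_cons; case: (P i); rewrite ?add0r.
rewrite big_cons; have [Pi|Pi] := boolP (P i); first by apply: is_deriveD; exact: FD.
rewrite [X in is_derive _ _ X](_ : _ = fun y => \sum_(i <- r | P i) F i y) //.
by apply/funext => y; rewrite add0r.
Qed.

Lemma differentiable_bigsum (W : normedModType R) (I : Type) (r : seq I)
    (P : pred I) (F : I -> U -> W) x :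
  (forall i, P i -> differentiable (F i) x) ->
  differentiable (fun y => \sum_(i <- r | P i) F i y) x.
Proof.
move=> FD; elim: r => [|i r IH].
  rewrite [X in differentiable X _](_ : _ = cst 0); first exact: differentiable_cst.
  by apply/funext => y; rewrite big_nil.
rewrite [X in differentiable X _](_ : _ = fun y => (if P i then F i y else 0) +
    \sum_(i <- r | P i) F i y); last first.
  by apply/funext => y; rewrite big_cons; case: (P i); rewrite ?add0r.
apply: differentiableD => //.
by have [Pi|Pi] := boolP (P i); [exact: FD|exact: differentiable_cst].
Qed.

Lemma is_derive_mulcl (f : U -> R^o) (c df : R) x v :
  is_derive x v f df -> is_derive x v (fun y => c * f y : R^o) (c * df).
Proof. by move=> fdf; exact: (is_deriveZ c fdf). Qed.

Lemma is_derive_mul (f g : U -> R^o) (df dg : R) x v :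
  is_derive x v f df -> is_derive x v g dg ->
  is_derive x v (fun y => f y * g y : R^o) (f x * dg + df * g x).
Proof.
move=> fdf gdg; rewrite [df * _]mulrC.
exact: (is_deriveM fdf gdg).
Qed.

(* d(G^* a) = G^*(da) at x for a map G of class C^1: g collects the components
   of G, b the coefficients of the 1-form a along G, B the derivatives of these
   coefficients at G x, and H w = (G^* a)(w). The quadratic Taylor primitive phi
   of a, pulled back by G, has first derivatives H w - Rem w, where Rem w only
   involves products of a function vanishing at x and a continuous one; so
   these are differentiable at x and derive_sym applies to phi. *)
Lemma exterior_chain d (g b : 'I_d -> U -> R^o) (B : 'M[R]_d) x u v :
  let H w := fun y => \sum_l b l y * 'D_w (g l) y : R^o in
  (forall l, Ck 1 (g l)) -> (forall l, differentiable (b l) x) ->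
  (forall l w, 'D_w (b l) x = \sum_k B k l * 'D_w (g k) x) ->
  differentiable (H u) x -> differentiable (H v) x ->
  'D_u (H v) x - 'D_v (H u) x =
  \sum_k \sum_l B k l * ('D_u (g k) x * 'D_v (g l) x - 'D_v (g k) x * 'D_u (g l) x).
Proof.
move=> H Cg db bB dHu dHv.
pose De k : U -> R^o := fun y => g k y - g k x.
pose phi : U -> R^o := fun y => \sum_l b l x * g l y +
  2^-1 * \sum_k \sum_l B k l * (De k y * De l y).
pose Rem w : U -> R^o := fun y =>
  \sum_l (b l y - b l x - \sum_k B k l * De k y) * 'D_w (g l) y +
  2^-1 * \sum_k \sum_l B k l * (De k y * 'D_w (g l) y - De l y * 'D_w (g k) y).
have dg l y : differentiable (g l) y by case: (Cg l) => + _; exact.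
have cg l w : continuous ('D_w (g l)) by case: (Cg l) => _; exact.
have gD l w y : is_derive y w (g l) ('D_w (g l) y).
  by apply: derivableP; exact: diff_derivable.
have DeD k w y : is_derive y w (De k) ('D_w (g k) y).
  rewrite -[X in is_derive _ _ _ X]subr0; exact: is_deriveB.
have dDe k y : differentiable (De k) y.
  by apply: differentiableB => //; exact: differentiable_cst.
have phiD w y : is_derive y w phi (H w y - Rem w y).
  rewrite (_ : H w y - Rem w y = \sum_l b l x * 'D_w (g l) y +
    2^-1 * \sum_k \sum_l B k l * (De k y * 'D_w (g l) y + De l y * 'D_w (g k) y)).
    apply: is_deriveD.
      by apply: is_derive_bigsum => l _; exact: is_derive_mulcl.
    apply: is_derive_mulcl; apply: is_derive_bigsum => k _.
    apply: is_derive_bigsum => l _; apply: is_derive_mulcl.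
  pose T := \sum_k \sum_l B k l * (De k y * 'D_w (g l) y).
  pose T' := \sum_k \sum_l B k l * (De l y * 'D_w (g k) y).
  have -> : \sum_k \sum_l B k l * (De k y * 'D_w (g l) y + De l y * 'D_w (g k) y)
      = T + T'.
    rewrite -big_split; apply: eq_bigr => k _; rewrite -big_split.
    by apply: eq_bigr => l _; rewrite mulrDr.
  rewrite /Rem.
  have -> : \sum_k \sum_l B k l * (De k y * 'D_w (g l) y - De l y * 'D_w (g k) y)
      = T - T'.
    rewrite -sumrB; apply: eq_bigr => k _; rewrite -sumrB.
    by apply: eq_bigr => l _; rewrite mulrBr.
  have -> : \sum_l (b l y - b l x - \sum_k B k l * De k y) * 'D_w (g l) y =
      H w y - \sum_l b l x * 'D_w (g l) y - T.
    rewrite /T exchange_big -!sumrB; apply: eq_bigr => l _.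
    rewrite !mulrBl mulr_suml; congr (_ - _).
    by apply: eq_bigr => k _; rewrite mulrA.
  by field.
(* By [bB], the coefficients in the first sum of [Rem] vanish at [x] together with their first
   derivatives, so this sum contributes nothing. The second sum carries the antisymmetric part of
   [B], that is da, which the symmetric quadratic part of [phi] cannot see. *)
have Rem0 w : differentiable (Rem w) x /\ forall z, 'D_z (Rem w) x =
  2^-1 * \sum_k \sum_l B k l * ('D_z (g k) x * 'D_w (g l) x - 'D_z (g l) x * 'D_w (g k) x).
  pose E l y : R^o := b l y - b l x - \sum_k B k l * De k y.
  have E0 l : E l x = 0.
    by rewrite /E subrr big1 ?subr0 // => k _; rewrite /De subrr mulr0.
  have dE l : differentiable (E l) x.
    apply: differentiableB.
      by apply: differentiableB => //; exact: differentiable_cst.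
    by apply: differentiable_bigsum => k _; exact: differentiableZ.
  have ED l z : 'D_z (E l) x = 0.
    apply: derive_val; rewrite [X in is_derive _ _ _ X](_ : _ =
      'D_z (b l) x - 0 - \sum_k B k l * 'D_z (g k) x); last first.
      by rewrite bB subr0 subrr.
    apply: is_deriveB; last by apply: is_derive_bigsum => k _; exact: is_derive_mulcl.
    by apply: is_deriveB; apply: derivableP; exact: diff_derivable.
  have De0 k : De k x = 0 by rewrite /De subrr.
  have P1 l := diffM_vanishing (dE l) (E0 l) (@cg l w x).
  have P2 k l := diffM_vanishing (dDe k x) (De0 k) (@cg l w x).
  split=> [|z].
    apply: differentiableD; first by apply: differentiable_bigsum => l _; exact: (P1 l).1.
    apply: differentiableZ; apply: differentiable_bigsum => k _.
    apply: differentiable_bigsum => l _; apply: differentiableZ.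
    by apply: differentiableB; [exact: (P2 k l).1|exact: (P2 l k).1].
  have S1 : is_derive x z (fun y => \sum_l E l y * 'D_w (g l) y : R^o)
      (\sum_(l < d) 0).
    apply: is_derive_bigsum => l _.
    apply: DeriveDef; first by apply: diff_derivable; exact: (P1 l).1.
    by rewrite (P1 l).2 ED mul0r.
  rewrite big1 // in S1.
  apply: derive_val; rewrite -[X in is_derive _ _ _ X]add0r; apply: is_deriveD S1 _.
  have P2D k l : is_derive x z (fun y => De k y * 'D_w (g l) y : R^o)
      ('D_z (g k) x * 'D_w (g l) x).
    apply: DeriveDef; first by apply: diff_derivable; exact: (P2 k l).1.
    by have [_ <-] := DeD k z x; rewrite (P2 k l).2.
  apply: is_derive_mulcl; apply: is_derive_bigsum => k _.
  by apply: is_derive_bigsum => l _; apply: is_derive_mulcl; exact: is_deriveB.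
have phiE w : 'D_w phi = (fun y => H w y - Rem w y) :> (U -> R^o).
  by apply/funext => y; exact: derive_val.
have dphi w y : derivable phi y w by have [] := phiD w y.
have dHR w : differentiable (H w) x -> differentiable ('D_w phi : U -> R^o) x.
  by move=> dH; rewrite phiE; apply: differentiableB => //; exact: (Rem0 w).1.
pose T := \sum_k \sum_l B k l * ('D_u (g k) x * 'D_v (g l) x).
pose T' := \sum_k \sum_l B k l * ('D_v (g k) x * 'D_u (g l) x).
have TE : \sum_k \sum_l B k l * ('D_v (g k) x * 'D_u (g l) x
    - 'D_v (g l) x * 'D_u (g k) x) = T' - T.
  rewrite -sumrB; apply: eq_bigr => k _; rewrite -sumrB.
  by apply: eq_bigr => l _; rewrite -mulrBr [X in _ * (_ - X)]mulrC.
have TE' : \sum_k \sum_l B k l * ('D_u (g k) x * 'D_v (g l) x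
    - 'D_u (g l) x * 'D_v (g k) x) = T - T'.
  rewrite -sumrB; apply: eq_bigr => k _; rewrite -sumrB.
  by apply: eq_bigr => l _; rewrite -mulrBr [X in _ * (_ - X)]mulrC.
have TF : \sum_k \sum_l B k l * ('D_u (g k) x * 'D_v (g l) x
    - 'D_v (g k) x * 'D_u (g l) x) = T - T'.
  rewrite -sumrB; apply: eq_bigr => k _; rewrite -sumrB.
  by apply: eq_bigr => l _; rewrite -mulrBr.
(* Symmetry of the second derivatives of [phi] leaves only the difference of the derivatives of the
   two remainders, each of which is half of the right-hand side up to sign. *)
have aux (p q r1 r2 t t' : R) : p - r1 = q - r2 -> r1 = 2^-1 * (t' - t) ->
    r2 = 2^-1 * (t - t') -> q - p = t - t'.
  by move=> E1 E2 E3; rewrite -[q](subrK r2) -E1 E2 E3; field.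
rewrite TF.
have Ru : 'D_v (Rem u) x = 2^-1 * (T' - T) by rewrite -TE; exact: (Rem0 u).2.
have Rv : 'D_u (Rem v) x = 2^-1 * (T - T') by rewrite -TE'; exact: (Rem0 v).2.
have DHR w z : differentiable (H w) x ->
    'D_z ('D_w phi : U -> R^o) x = 'D_z (H w) x - 'D_z (Rem w) x.
  move=> dH; rewrite phiE; apply: deriveB; apply: diff_derivable; first exact: dH.
  exact: (Rem0 w).1.
apply: aux _ Ru Rv.
apply: etrans (esym (DHR u v dHu)) (etrans _ (DHR v u dHv)).
exact: derive_sym (dphi u) (dphi v) (dHR u dHu) (dHR v dHv).
Qed.

End PullbackD.

(** * Periodic functions *)

Definition zperiodic (R : realType) d (T : Type) (f : 'rV[R]_d -> T) :=
  forall x k, k \is a mxOver Num.int -> f (x + k) = f x.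

Section Periodic.
Context {R : realType} {d : nat}.
Implicit Types (x k : 'rV[R]_d).

Definition unit_cube : set 'rV[R]_d := [set x | forall j, x 0 j \in `[0, 1]].

Lemma unit_cube_compact : compact unit_cube.
Proof.
have -> : unit_cube = [set x : 'rV[R]_d | forall j, `[0, 1]%classic (x ord0 j)].
  by [].
exact: (@rV_compact R d (fun=> `[0, 1]%classic) (fun=> @segment_compact R 0 1)).
Qed.

Lemma unit_cube_reduce x : exists2 k, k \is a mxOver Num.int & unit_cube (x + k).
Proof.
exists (\row_j - (Num.floor (x 0 j))%:~R).
  by apply/mxOverP => i j; rewrite mxE rpredN intr_int.
move=> j; rewrite !mxE in_itv /= subr_ge0 floor_le lerBlDr addrC.
by rewrite -[1]/(1%:~R) -intrD ltW // floorD1_gt.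
Qed.

Lemma unit_cube_neq0 : unit_cube !=set0.
Proof. by have [k _ k0] := unit_cube_reduce 0; exists (0 + k). Qed.

Lemma periodic_bounded (f : 'rV[R]_d -> R^o) :
  continuous f -> zperiodic f -> exists2 M, 0 < M & forall x, `|f x| <= M.
Proof.
move=> cf pf.
have cn : {within unit_cube, continuous (fun x => `|f x|)}.
  apply: continuous_subspaceT => x; apply: continuous_comp; first exact: cf.
  exact: norm_continuous.
have [c _ cM] := EVT_max_rV unit_cube_neq0 unit_cube_compact cn.
exists (`|f c| + 1) => [|x]; first by rewrite ltr_wpDl.
have [k kZ xk] := unit_cube_reduce x.
by rewrite -(pf x k kZ) ler_wpDr // cM // inE.
Qed.

End Periodic.

(* The difference quotients of a periodic vector field with small step 1/N sum
   to zero over the grid of mesh 1/N, whereas they all are positive if the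
   divergence is. *)
Section Divergence.
Context {R : realType} {d m : nat} (e : 'I_m -> 'I_d).
Variable V : 'I_m -> 'rV[R]_d -> R^o.
Local Notation E i := (delta_mx 0 (e i) : 'rV[R]_d).
Hypothesis perV : forall i, zperiodic (V i).
Hypothesis derV : forall i x, derivable (V i) x (E i).
Hypothesis contD : forall i, continuous ('D_(E i) (V i) : 'rV[R]_d -> R^o).

Let diffquot (h : R) (x : 'rV[R]_d) := \sum_i (V i (h *: E i + x) - V i x).

Lemma norm_delta_mx1 (j : 'I_d) : `|delta_mx 0 j : 'rV[R]_d| <= 1.
Proof.
rewrite /Num.Def.normr /= mx_normrE; apply: bigmax_le => // -[a b] _ /=.
by rewrite mxE; case: (_ && _); rewrite ?normr1 ?normr0.
Qed.

(** Positivity is stated jointly in the point and the step, the form from which compactness of the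
    cube extracts one step that serves all points. *)
Lemma diffquot_gt0 x0 : 0 < \sum_i 'D_(E i) (V i) x0 ->
  \forall x \near x0 & h \near 0^'+, 0 < diffquot h x.
Proof.
set S := \sum_i _ => S0.
(* Each of the [m] partial derivatives may drop by [eps], and m eps < S, also when [m] is 0. *)
pose eps := S / m.+1%:R.
have eps0 : 0 < eps by rewrite divr_gt0.
have [r r0 rP] : exists2 r : R, 0 < r & forall i y, `|x0 - y| < r ->
    `|'D_(E i) (V i) x0 - 'D_(E i) (V i) y| < eps.
  have : \forall y \near x0, forall i,
      `|'D_(E i) (V i) x0 - 'D_(E i) (V i) y| < eps.
    have H i : \forall y \near x0, `|'D_(E i) (V i) x0 - 'D_(E i) (V i) y| < eps.
      by have /cvgrPdist_lt := @contD i x0; apply.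
    exact: filter_forall H.
  by move=> /nbhs_normP[r r0 rP]; exists r => // i y xy; exact: rP.
have r20 : 0 < r / 2 by rewrite divr_gt0.
exists ([set x | `|x0 - x| < r / 2], [set h | 0 < h < r / 2]).
  split => /=; first by have /cvgrPdist_lt := @cvg_id _ (nbhs x0); apply.
  exists (r / 2) => // h /=; rewrite sub0r normrN => hr h0.
  by rewrite h0 -(gtr0_norm h0).
move=> [x h] /= [xr /andP[h0 hr]].
have step i : h * ('D_(E i) (V i) x0 - eps) <= V i (h *: E i + x) - V i x.
  have D s : is_derive (s : R) (1 : R) (fun t : R => V i (t *: E i + x) : R^o)
      ('D_(E i) (V i) (s *: E i + x)).
    exact: is_derive_line.
  have [|xi + /=] := MVT h0 (fun s _ => D s).
    apply: continuous_subspaceT => s; apply: differentiable_continuous.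
    by apply/derivable1_diffP; have [] := D s.
  rewrite in_itv /= scale0r add0r subr0 => /andP[xi0 xih] ->.
  rewrite [leRHS]mulrC ler_pM2l // lerBlDr -lerBlDl.
  apply: le_trans (ler_norm _) (ltW (rP _ _ _)).
  rewrite opprD addrCA (le_lt_trans (ler_normD _ _)) // (splitr r) ler_ltD //.
  rewrite normrN normrZ gtr0_norm // -[leRHS]mulr1 ler_pM ?norm_delta_mx1 //.
    exact: ltW.
  exact: ltW (lt_trans xih hr).
apply: (@lt_le_trans _ _ (\sum_i h * ('D_(E i) (V i) x0 - eps))).
  rewrite -mulr_sumr mulr_gt0 // sumrB sumr_const card_ord subr_gt0 -/S.
  by rewrite -[eps *+ m]mulr_natr /eps mulrAC ltr_pdivrMr // ltr_pM2l // ltr_nat.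
by apply: ler_sum.
Qed.

Theorem periodic_divergence : ~ (forall x, 0 < \sum_i 'D_(E i) (V i) x).
Proof.
move=> divV.
have cov := (compact_near_coveringP _).1 (@unit_cube_compact R d).
have [r /= r0 rP] := cov _ (0 : R)^'+ (fun h x => 0 < diffquot h x) _
  (fun x _ => diffquot_gt0 (divV x)).
pose N := (Num.truncn r^-1).+1.
have N0 : 0 < N%:R :> R by rewrite ltr0n.
have Nr : N%:R^-1 < r.
  by rewrite invf_plt // ?posrE //; exact: truncnS_gt.
have {rP} posN x : unit_cube x -> 0 < diffquot N%:R^-1 x.
  by apply: rP; rewrite ?invr_gt0 //= sub0r normrN gtr0_norm ?invr_gt0.
pose pt (k : {ffun 'I_d -> 'I_N}) : 'rV[R]_d := \row_j ((k j)%:R / N%:R).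
pose sh j (k : {ffun 'I_d -> 'I_N}) := [ffun a => if a == j then ordS (k a) else k a].
(* A step beyond the last grid point returns to coordinate 0; the discrepancy is the integer (k_j +
   1) %/ N, which is 0 or 1, and periodicity absorbs it. *)
have shE j i k : V i (N%:R^-1 *: delta_mx 0 j + pt k) = V i (pt (sh j k)).
  rewrite -(perV i (pt (sh j k)) (k := ((k j).+1 %/ N)%:R *: delta_mx 0 j)).
    congr (V i _); apply/rowP => a; rewrite !mxE ffunE.
    have [->|aj] := eqVneq a j; last by rewrite !mulr0 add0r addr0.
    rewrite ?eqxx !mulr1 -[X in _ = _ + X](mulfK (lt0r_neq0 N0)) -mulrDl -natrM -natrD.
    by rewrite addnC -divn_eq -[(k j).+1]add1n natrD mulrDl mul1r.
  by apply/mxOverP => a b; rewrite !mxE rpredM ?rpred_nat.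
have sh_bij j : bijective (sh j).
  exists (fun k : {ffun 'I_d -> 'I_N} =>
    [ffun a => if a == j then ord_pred (k a) else k a]) => k.
    by apply/ffunP => a; rewrite !ffunE; case: eqP => // _; rewrite ordSK.
  by apply/ffunP => a; rewrite !ffunE; case: eqP => // _; rewrite ord_predK.
have ptC k : unit_cube (pt k).
  move=> j; rewrite mxE in_itv /= divr_ge0 //= ler_pdivrMr // mul1r ler_nat.
  exact: ltnW.
have : \sum_k diffquot N%:R^-1 (pt k) = 0.
  rewrite exchange_big big1 //= => i _; rewrite sumrB; apply/eqP.
  rewrite subr_eq0; apply/eqP; under eq_bigr do rewrite shE.
  by rewrite [RHS](reindex (sh (e i))) //; exact: onW_bij.
apply/eqP; rewrite gt_eqF // (bigD1 [ffun=> ord0]) //=.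
by rewrite ltr_pwDl ?posN // sumr_ge0 // => k _; exact/ltW/posN.
Qed.

End Divergence.

(** * Exact 2-forms on tori *)

Section DetDerivative.
Context {R : realType} {U : normedModType R}.

Lemma is_derive_prod_uniq (I : eqType) (r : seq I) (F : I -> U -> R^o)
    (D : I -> R) x v :
  uniq r -> (forall i, is_derive x v (F i) (D i)) ->
  is_derive x v (fun y => \prod_(i <- r) F i y : R^o)
    (\sum_(i <- r) \prod_(j <- r) if j == i then D j else F j x).
Proof.
move=> + FD; elim: r => [_|a r IH /= /andP[ar ur]].
  rewrite big_nil [X in is_derive _ _ X](_ : _ = cst 1); first exact: is_derive_cst.
  by apply/funext => y; rewrite big_nil.
rewrite [X in is_derive _ _ X](_ : _ =
    fun y => F a y * \prod_(i <- r) F i y : R^o); last first.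
  by apply/funext => y; rewrite big_cons.
apply: is_derive_eq (is_derive_mul (FD a) (IH ur)) _.
rewrite big_cons big_cons eqxx addrC; congr (_ * _ + _).
  by apply: eq_big_seq => j jr; case: eqP => // ja; rewrite -ja jr in ar.
rewrite mulr_sumr; apply: eq_big_seq => i ir; rewrite big_cons.
by case: eqP => // ai; rewrite ai ir in ar.
Qed.

(** Jacobi's formula: the product rule replaces one row at a time by its derivative, as in [M'], and
    expansion along that row produces the adjugate. *)
Lemma is_derive_det n (M : U -> 'M[R]_n) (D : 'M[R]_n) x v :
  (forall i j, is_derive x v (fun y => M y i j : R^o) (D i j)) ->
  is_derive x v (fun y => \det (M y) : R^o) (\tr (D *m \adj (M x))).
Proof.
move=> MD; pose M' i := \matrix_(a, b) (if a == i then D a b else M x a b).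
have -> : \tr (D *m \adj (M x)) = \sum_i \det (M' i).
  apply: eq_bigr => i _; rewrite (expand_det_row _ i) mxE.
  apply: eq_bigr => j _; rewrite !mxE eqxx; congr (_ * (_ * \det _)).
  by apply/matrixP => a b; rewrite !mxE eq_sym (negPf (neq_lift _ _)).
rewrite /determinant exchange_big; apply: is_derive_bigsum => s _.
rewrite -mulr_sumr; apply: is_derive_mulcl.
under eq_bigr do under eq_bigr do rewrite mxE.
apply: is_derive_eq (is_derive_prod_uniq (index_enum_uniq _) (fun i => MD i (s i))) _.
by [].
Qed.

End DetDerivative.

(* The pointwise content of div (rho X) = (m/2) rho for X = L Om^-1, the
   Liouville field of Om = dL, and rho = |det Om|^(1/2): P, M and Q stand for the
   first derivatives of X, L and Om. *)
Lemma liouville_identity (R : realFieldType) m (Om N P M : 'M[R]_m)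
    (Q : 'I_m -> 'M[R]_m) (X : 'I_m -> R) :
  Om *m N = 1%:M -> Om = M - M^T ->
  (forall i j k, Q k i j + Q i j k + Q j k i = 0) ->
  (forall i j k, Q k i j = - Q k j i) ->
  (forall k j, \sum_i (P k i * Om i j + X i * Q k i j) = M k j) ->
  \sum_i (2^-1 * \tr (Q i *m N) * X i + P i i) = m%:R / 2.
Proof.
move=> ON OM Qc Qa H.
have OT : Om^T = - Om by rewrite OM linearB /= trmxK opprB.
have NO : N *m Om = 1%:M by exact: mulmx1C.
have NT : N^T = - N.
  rewrite -[LHS]mulmx1 -ON mulmxA -[N^T *m Om]opprK -mulmxN -OT -trmx_mul ON.
  by rewrite trmx1 mulNmx mul1mx.
pose W := \matrix_(k, j) \sum_i X i * Q k i j.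
(* The derivative of L = X Om reads M = P Om + W. So tr P = tr(M N) - tr(W N), and the second term
   will cancel the derivative of the density. *)
have PE : P = (M - W) *m N.
  suff -> : M - W = P *m Om by rewrite -mulmxA ON mulmx1.
  apply/matrixP => k j; rewrite !mxE -H big_split /= addrK //.
have trMN : \tr (M *m N) = m%:R / 2.
  have : \tr (Om *m N) = m%:R by rewrite ON mxtrace1.
  rewrite OM mulmxBl linearB /=.
  have -> : \tr (M^T *m N) = - \tr (M *m N).
    by rewrite -mxtrace_tr trmx_mul trmxK NT mulNmx linearN /= mxtrace_mulC.
  by move=> <-; field.
(* Closedness of [Om] enters here: paired with the antisymmetric [N], the cyclic identity exchanges
   the index of differentiation with a matrix index at the cost of a factor 1/2. As tr(Q_i N) is the
   logarithmic derivative of det Om, the right-hand side is the derivative of log rho along [X]. *)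
have trWN : \tr (W *m N) = \sum_i 2^-1 * \tr (Q i *m N) * X i.
  have Na a b : N a b = - N b a.
    by have := congr1 (fun A : 'M[R]_m => A b a) NT; rewrite !mxE.
  have S i : \tr (Q i *m N) = 2 * \sum_k \sum_j Q k i j * N j k.
    transitivity (\sum_j \sum_k (Q k i j * N j k + Q j i k * N k j)).
      apply: eq_bigr => j _; rewrite mxE; apply: eq_bigr => k _.
      rewrite (Na j k); have := Qc i j k; rewrite (Qa k i j).
      by move=> /eqP; rewrite subr_eq0 => /eqP <-; ring.
    under eq_bigr do rewrite big_split; rewrite big_split /=.
    by rewrite mulr_natl mulr2n; congr (_ + _); exact: exchange_big.
  under [RHS]eq_bigr do rewrite S mulrA mulVf ?pnatr_eq0 // mul1r mulr_suml.
  rewrite exchange_big /=; apply: eq_bigr => k _; rewrite mxE.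
  under [RHS]eq_bigr do rewrite mulr_suml.
  rewrite exchange_big /=; apply: eq_bigr => j _; rewrite mxE mulr_suml.
  by apply: eq_bigr => i _; rewrite -mulrA mulrC.
rewrite big_split /= -trWN -[\sum_i P i i]/(\tr P) PE mulmxBl linearB /= trMN.
by rewrite addrC subrK.
Qed.

Section ExactNondegenerate.
Context {R : realType} {d m : nat} (e : 'I_m -> 'I_d).
Variable L : 'I_m -> 'rV[R]_d -> R^o.
Local Notation E i := (delta_mx 0 (e i) : 'rV[R]_d).
Hypothesis L2 : forall j, Ck 2 (L j).
Hypothesis perL : forall j, zperiodic (L j).
Let dL i j : 'rV[R]_d -> R^o := 'D_(E i) (L j).
Let Om x : 'M[R]_m := \matrix_(i, j) (dL i j x - dL j i x).

Lemma Ck1_dL i j : Ck 1 (dL i j).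
Proof. by case: (L2 j) => _; exact. Qed.

Lemma Ck1_Om i j : Ck 1 (fun x => Om x i j : R^o).
Proof.
rewrite [X in Ck _ X](_ : _ = fun x => dL i j x - dL j i x).
  by apply: CkB; exact: Ck1_dL.
by apply/funext => x; rewrite mxE.
Qed.

Lemma zperiodic_derive (W : normedModType R) (f : 'rV[R]_d -> W) v :
  zperiodic f -> zperiodic ('D_v f).
Proof.
move=> pf x k kZ; rewrite /derive.
suff -> : (fun h => h^-1 *: ((f \o shift (x + k)) (h *: v) - f (x + k))) =
  (fun h => h^-1 *: ((f \o shift x) (h *: v) - f x)) by [].
by apply/funext => h /=; rewrite addrA !(pf _ _ kZ).
Qed.

(** d(dL) = 0: by Schwarz's theorem the six second derivatives cancel in pairs. *)
Lemma Om_closed x i j k :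
  'D_(E k) (fun x => Om x i j : R^o) x + 'D_(E i) (fun x => Om x j k : R^o) x
  + 'D_(E j) (fun x => Om x k i : R^o) x = 0.
Proof.
have aux (a b c a' b' c' : R) :
    a = a' -> b = b' -> c = c' -> a - b + (c - a') + (b' - c') = 0.
  by move=> -> -> ->; ring.
have DOm a b c : 'D_(E a) (fun x => Om x b c : R^o) x =
    'D_(E a) (dL b c) x - 'D_(E a) (dL c b) x.
  have -> : (fun x => Om x b c : R^o) = dL b c \- dL c b.
    by apply/funext => y; rewrite mxE.
  have [dd _] := Ck1_dL b c; have [dd' _] := Ck1_dL c b.
  by apply: deriveB; apply: diff_derivable; [exact: dd|exact: dd'].
have sym a b c : 'D_(E a) (dL b c) x = 'D_(E b) (dL a c) x.
  have [dLc _] := L2 c; have [dac _] := Ck1_dL a c; have [dbc _] := Ck1_dL b c.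
  by apply: derive_sym; [move=> y; exact: diff_derivable
    |move=> y; exact: diff_derivable|exact: dbc|exact: dac].
rewrite (DOm k i j) (DOm i j k) (DOm j k i).
exact: aux (sym k i j) (sym k j i) (sym i j k).
Qed.

(** Only the [m] directions selected by [e] are differentiated, while the functions live on R^d. In
    the application d = m + 1: the coefficients of a form on the base are kept as functions on the
    whole product, and need not be descended to the base. *)
Theorem exact_degenerate : (0 < m)%N -> ~ (forall x, \det (Om x) != 0).
Proof.
move=> m0 dO.
pose N x := invmx (Om x).
pose X i x : R^o := \sum_j L j x * N x j i.
(* rho = |det Om|^(1/2) *)
pose rho x : R^o := Num.sqrt (Num.sqrt (\det (Om x) ^+ 2)).
have rho0 x : 0 < rho x.
  by rewrite !sqrtr_gt0 exprn_even_gt0 //= dO.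
have Crho : Ck 1 rho.
  apply: Ck1_sqrt => [x|]; first by rewrite sqrtr_gt0 exprn_even_gt0 //= dO.
  apply: Ck1_sqrt => [x|]; first by rewrite exprn_even_gt0 //= dO.
  by under eq_fun do rewrite expr2; apply: CkM; apply: Ck_det => i j; exact: Ck1_Om.
have CN i j : Ck 1 (fun x => N x i j : R^o).
  by apply: Ck_invmx => // a b; exact: Ck1_Om.
have CL j : Ck 1 (L j) by exact: CkW (L2 j).
have CX i : Ck 1 (X i).
  by apply: Ck_sum => j _; apply: CkM.
pose V i x : R^o := rho x * X i x.
have CV i : Ck 1 (V i) by exact: CkM.
apply: (@periodic_divergence R d m e V).
- move=> i x k kZ.
  have OmE : Om (x + k) = Om x.
    apply/matrixP => a b; rewrite !mxE /dL.
    by rewrite !(zperiodic_derive _ (@perL _) _ kZ).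
  rewrite /V /rho OmE; congr (_ * _); apply: eq_bigr => j _.
  by rewrite (perL j _ kZ) /N OmE.
- by move=> i x; apply: diff_derivable; case: (CV i) => + _; exact.
- by move=> i; case: (CV i) => _; exact.
move=> x.
have ON y : Om y *m N y = 1%:M by rewrite mulmxV // unitmxE unitfE dO.
have OD k i j : is_derive x (E k) (fun y => Om y i j : R^o)
    ('D_(E k) (fun y => Om y i j : R^o) x).
  apply: derivableP; apply: diff_derivable; case: (Ck1_Om i j) => + _; exact.
have XD k i : is_derive x (E k) (X i) ('D_(E k) (X i) x).
  apply: derivableP; apply: diff_derivable; case: (CX i) => + _; exact.
have rD k : is_derive x (E k) rho ('D_(E k) rho x).
  apply: derivableP; apply: diff_derivable; case: Crho => + _; exact.
have [Q QE] : exists Q : 'I_m -> 'M[R]_m, forall k i j,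
    Q k i j = 'D_(E k) (fun y => Om y i j : R^o) x.
  by exists (fun k => \matrix_(i, j) 'D_(E k) (fun y => Om y i j : R^o) x) => k i j;
    rewrite mxE.
have detD k : is_derive x (E k) (fun y => \det (Om y) : R^o)
    (\det (Om x) * \tr (Q k *m N x)).
  have H : forall i j, is_derive x (E k) (fun y => Om y i j : R^o) (Q k i j).
    by move=> i j; rewrite QE; exact: OD.
  suff <- : \tr (Q k *m \adj (Om x)) = \det (Om x) * \tr (Q k *m N x).
    exact: is_derive_det H.
  rewrite -mxtraceZ scalemxAr /N /invmx unitmxE unitfE dO.
  by rewrite scalerA mulfV ?dO // scale1r.
have rho4 y : rho y * rho y * (rho y * rho y) = \det (Om y) * \det (Om y).
  by rewrite -!expr2 /rho !sqr_sqrtr ?sqr_ge0 ?sqrtr_ge0.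
(* Both sides of rho^4 = (det Om)^2 are differentiated, and the result is divided by 4 rho^3; the
   sign of the determinant never intervenes. *)
have rhoD k : 'D_(E k) rho x = rho x * (2^-1 * \tr (Q k *m N x)).
  have r2D := is_derive_mul (rD k) (rD k).
  have [_ D1] := is_derive_mul r2D r2D.
  have [_ D2] := is_derive_mul (detD k) (detD k).
  have D12 := etrans (esym D1) (etrans (congr1 (fun h : _ -> R^o => 'D_(E k) h x)
    (funext rho4)) D2).
  have r0 := rho0 x; have r4 := rho4 x; clear -D12 r0 r4.
  move: (rho x) ('D_(E k) rho x) (\det _) (\tr _) D12 r0 r4 => r r' D t D12 r0 r4.
  have r3 : 4 * (r * r * r) != 0 by rewrite !mulf_neq0 ?gt_eqF.
  apply: (mulfI r3); transitivity (2 * (D * D) * t).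
    by transitivity (D * (D * t) + D * t * D); [rewrite -D12; ring|ring].
  by rewrite -r4; field.
have XO y j : L j y = \sum_i X i y * Om y i j.
  have NO : N y *m Om y = 1%:M by apply: mulmx1C.
  under eq_bigr do rewrite mulr_suml.
  rewrite exchange_big /= (bigD1 j) //= [X in _ + X]big1 ?addr0 => [|k kj].
    have := congr1 (fun A : 'M[R]_m => A j j) NO; rewrite mxE [in RHS]mxE eqxx => NOj.
    by rewrite -[LHS]mulr1 -[X in _ * X]NOj mulr_sumr;  apply: eq_bigr => i _; rewrite mulrA.
  have := congr1 (fun A : 'M[R]_m => A k j) NO; rewrite mxE [in RHS]mxE (negPf kj) => NOj.
  rewrite -[RHS](mulr0 (L k y)) -[X in _ = _ * X]NOj mulr_sumr.
  by apply: eq_bigr => i _; rewrite mulrA.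
pose P := \matrix_(k, i) 'D_(E k) (X i) x.
have VD i : 'D_(E i) (V i) x = rho x * (2^-1 * \tr (Q i *m N x) * X i x + P i i).
  have [_ ->] := is_derive_mul (rD i) (XD i i).
  by rewrite rhoD mxE; ring.
under eq_bigr do rewrite VD.
have m2 : 0 < m%:R / 2 :> R by rewrite divr_gt0 ?ltr0n.
suff -> : \sum_i rho x * (2^-1 * \tr (Q i *m N x) * X i x + P i i) = rho x * (m%:R / 2).
  by rewrite pmulr_rgt0.
rewrite -mulr_sumr; congr (_ * _).
apply: (@liouville_identity R m (Om x) (N x) P (\matrix_(k, j) dL k j x)).
- exact: ON.
- by apply/matrixP => i j; rewrite !mxE.
- by move=> i j k; rewrite !QE; exact: (Om_closed x i j k).
- move=> i j k; rewrite (QE k i j) (QE k j i).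
  have -> : (fun y => Om y i j : R^o) = (fun y => - (Om y j i) : R^o).
    by apply/funext => y; rewrite !mxE opprB.
  by have [? _] := OD k j i; exact: deriveN.
- move=> k j; rewrite [RHS]mxE.
  have XOE : L j = (fun y => \sum_i X i y * Om y i j : R^o) by apply/funext => y; exact: XO.
  have : is_derive x (E k) (fun y => \sum_i X i y * Om y i j : R^o)
      (\sum_i (X i x * Q k i j + P k i * Om x i j)).
    apply: is_derive_bigsum => i _; rewrite QE [P k i]mxE.
    exact: (is_derive_mul (XD k i) (OD k i j)).
  rewrite -XOE => -[_ E1]; apply: etrans (esym E1).
  by apply: eq_bigr => i _; rewrite addrC.
Qed.

End ExactNondegenerate.

(** * Wedge products of top degree *)

Section Wedge.
Context {R : realType}.

Lemma multilinearP k m (a : 'M[R]_(k, m) -> R) : multilinear a <->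
  forall (A B C : 'M[R]_(k, m)) i b c,
    row i A = b *: row i B + c *: row i C ->
    (forall j, j != i -> row j B = row j A) ->
    (forall j, j != i -> row j C = row j A) -> a A = b * a B + c * a C.
Proof.
have row'P (A B : 'M[R]_(k, m)) i :
    row' i B = row' i A <-> (forall j, j != i -> row j B = row j A).
  split=> [E j ji|E].
    have [j' jE] : exists j', j = lift i j'.
      by case: (unliftP i j) => [j' ->|jE]; [exists j'|rewrite jE eqxx in ji].
    apply/rowP => l; have /matrixP/(_ j' l) := E.
    by rewrite !mxE jE.
  apply/matrixP => j l; have /rowP/(_ l) := E (lift i j) (negbT (lift_eqF i j)).
  by rewrite !mxE.
split=> H A B C i b c E1 E2 E3; apply: (H A B C i) => //; exact/row'P.
Qed.

Lemma wedge_multilinear p q m (a : 'M[R]_(p, m) -> R) (b : 'M[R]_(q, m) -> R) :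
  multilinear a -> multilinear b -> multilinear (wedge a b).
Proof.
move=> /multilinearP aM /multilinearP bM; apply/multilinearP.
have auxl (N e x y u v w : R) :
    N * (e * (x * u + y * v) * w) = x * (N * (e * u * w)) + y * (N * (e * v * w)).
  by ring.
have auxr (N e x y u v w : R) :
    N * (e * w * (x * u + y * v)) = x * (N * (e * w * u)) + y * (N * (e * w * v)).
  by ring.
move=> A B C i x y Ai AB AC; rewrite /wedge !mulr_sumr -big_split /=.
apply: eq_bigr => s _; set N := (_ ^-1).
have rU (X : 'M[R]_(p + q, m)) u : row u (usubmx (row_perm s X)) = row (s (lshift q u)) X.
  by apply/rowP => l; rewrite !mxE.
have rD (X : 'M[R]_(p + q, m)) u : row u (dsubmx (row_perm s X)) = row (s (rshift p u)) X.
  by apply/rowP => l; rewrite !mxE.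
have sK u : s u = i -> forall v, v != u -> s v != i.
  by move=> <- v; rewrite (inj_eq perm_inj).
have [u su|v sv] := split_ordP (s^-1%g i).
  have {}su : s (lshift q u) = i by rewrite -su permKV.
  have E X : (forall j, j != i -> row j X = row j A) ->
      dsubmx (row_perm s X) = dsubmx (row_perm s A).
    move=> XA; apply/row_matrixP => v; rewrite !rD XA //.
    by apply: sK su _ _; rewrite eq_sym eq_lrshift.
  rewrite (E B AB) (E C AC).
  rewrite (aM _ (usubmx (row_perm s B)) (usubmx (row_perm s C)) u x y); last 3 first.
  - by rewrite !rU su.
  - by move=> j ju; rewrite !rU AB //; apply: sK su _ _; rewrite (inj_eq (@lshift_inj _ _)).
  - by move=> j ju; rewrite !rU AC //; apply: sK su _ _; rewrite (inj_eq (@lshift_inj _ _)).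
  exact: auxl.
have {}sv : s (rshift p v) = i by rewrite -sv permKV.
have E X : (forall j, j != i -> row j X = row j A) ->
    usubmx (row_perm s X) = usubmx (row_perm s A).
  move=> XA; apply/row_matrixP => u; rewrite !rU XA //.
  by apply: sK sv _ _; rewrite eq_lrshift.
rewrite (E B AB) (E C AC).
rewrite (bM _ (dsubmx (row_perm s B)) (dsubmx (row_perm s C)) v x y); last 3 first.
- by rewrite !rD sv.
- by move=> j ju; rewrite !rD AB //; apply: sK sv _ _; rewrite (inj_eq (@rshift_inj _ _)).
- by move=> j ju; rewrite !rD AC //; apply: sK sv _ _; rewrite (inj_eq (@rshift_inj _ _)).
exact: auxr.
Qed.

Lemma wedge_row_perm p q m (a : 'M[R]_(p, m) -> R) (b : 'M[R]_(q, m) -> R) t A :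
  wedge a b (row_perm t A) = (-1) ^+ t * wedge a b A.
Proof.
rewrite /wedge mulrCA; congr (_ * _); rewrite mulr_sumr.
rewrite [RHS](reindex_inj (mulIg t)); apply: eq_bigr => s _ /=.
rewrite row_permM !mulrA; congr (_ * _ * _).
by rewrite odd_permM signr_addb mulrC -mulrA -signr_addb addbb mulr1.
Qed.

Lemma wedge_exp_multilinear m (b : 'M[R]_(2, m) -> R) n :
  multilinear b -> multilinear (@wedge_exp R m b n).
Proof.
move=> bM; elim: n => [|n IH] /=; first by move=> A B C [].
exact: wedge_multilinear.
Qed.

(** Uniqueness of the form of top degree. Sign change under permutations of the rows is what
    [wedge_row_perm] provides; it implies vanishing on repeated rows because 2 is invertible. *)
Lemma multilinear_det n (phi : 'M[R]_n -> R) :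
  multilinear phi ->
  (forall (t : 'S_n) A, phi (row_perm t A) = (-1) ^+ t * phi A) ->
  forall A, phi A = \det A * phi 1%:M.
Proof.
move=> phiM phiS.
pose psi A := phi A - \det A * phi 1%:M.
suff psi0 A : psi A = 0 by move=> A; apply/eqP; rewrite -subr_eq0; apply/eqP; exact: psi0.
have psiM : multilinear psi.
  move=> X Y Z i b c E1 E2 E3; rewrite /psi (phiM _ _ _ _ _ _ E1 E2 E3).
  rewrite (determinant_multilinear E1 E2 E3).
  by move: (phi _) (phi _) (\det _) (\det _) (phi _) => *; ring.
have psiS t X : psi (row_perm t X) = (-1) ^+ t * psi X.
  by rewrite /psi phiS row_permE det_mulmx det_perm mulrBr mulrA.
pose upd (X : 'M[R]_n) i (v : 'rV[R]_n) := \matrix_(a, b) if a == i then v 0 b else X a b.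
have updi X i v : row i (upd X i v) = v by apply/rowP => l; rewrite !mxE eqxx.
have updj X i v j : j != i -> row j (upd X i v) = row j X.
  by move=> ji; apply/rowP => l; rewrite !mxE (negPf ji).
have updlin X i b c u v : psi (upd X i (b *: u + c *: v)) =
    b * psi (upd X i u) + c * psi (upd X i v).
  apply: ((multilinearP psi).1 psiM _ _ _ i); first by rewrite !updi.
    by move=> j ji; rewrite !updj.
  by move=> j ji; rewrite !updj.
have base X : (forall i, exists j, row i X = delta_mx 0 j) -> psi X = 0.
  move=> /choice[f fX].
  have [finj|] := boolP (injectiveb f).
    have -> : X = row_perm (perm (injectiveP _ finj)) 1%:M.
      by apply/row_matrixP => i; rewrite fX; apply/rowP => l; rewrite !mxE permE eqxx eq_sym.
    by rewrite psiS /psi det1 mul1r subrr mulr0.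
  move=> /injectivePn[i [j ij fij]].
  have XE : row_perm (tperm i j) X = X.
    apply/row_matrixP => l; have -> : row l (row_perm (tperm i j) X) = row (tperm i j l) X.
      by apply/rowP => ?; rewrite !mxE.
    by rewrite !fX; case: tpermP => // ->; rewrite fij.
  have := psiS (tperm i j) X; rewrite XE odd_tperm ij mulN1r => /eqP.
  by rewrite -addr_eq0 -mulr2n mulrn_eq0 /= => /eqP.
(* Here [k] counts the leading rows that are still arbitrary; the induction expands the last of them
   in the standard basis. *)
suff H k X : (forall i : 'I_n, (k <= i)%N -> exists j, row i X = delta_mx 0 j) -> psi X = 0.
  by apply: (H n) => i; rewrite leqNgt ltn_ord.
elim: k X => [|k IH] X XD; first by apply: base => i; exact: XD.
have [kn|nk] := ltnP k n; last first.
  by apply: IH => i ki; have := leq_ltn_trans nk (leq_ltn_trans ki (ltn_ord i)); rewrite ltnn.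
pose i := Ordinal kn.
have updD j : psi (upd X i (delta_mx 0 j)) = 0.
  apply: IH => l; rewrite leq_eqVlt => /predU1P[kl|kl].
    by exists j; have -> : l = i by [apply: val_inj]; rewrite updi.
  have [j' lE] := XD l kl; exists j'; rewrite updj //.
  by apply: contraTneq kl => ->; rewrite ltnn.
have -> : X = upd X i (row i X).
  by apply/matrixP => a b; rewrite !mxE; case: eqP => // ->.
rewrite [row i X]row_sum_delta; elim/big_ind: _ => [|u v u0 v0|j _].
- by have := updlin X i 0 0 0 0; rewrite !scale0r !mul0r !addr0.
- by have := updlin X i 1 1 u v; rewrite !scale1r u0 v0 !mulr0 addr0.
- have := updlin X i (row i X 0 j) 0 (delta_mx 0 j) (delta_mx 0 j).
  by rewrite scale0r addr0 updD !mulr0 addr0.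
Qed.

(** In every term of the sum row [i] is an argument of exactly one factor [b], whose other argument
    is again a row of [A]. The hypothesis quantifies over pairs of rows of [A] so that it passes to
    the submatrices met in the induction. *)
Lemma wedge_exp_radical m (b : 'M[R]_(2, m) -> R) n (A : 'M[R]_(n * 2, m)) i :
  (forall X : 'M[R]_(2, m), (forall k, exists l, row k X = row l A) ->
    (exists k, row k X = row i A) -> b X = 0) ->
  wedge_exp b A = 0.
Proof.
elim: n A i => [|n IH] A i bA; first by have := ltn_ord i.
rewrite /= /wedge big1 ?mulr0 // => s _.
have rU (u : 'I_2) : row u (@usubmx _ 2 _ _ (row_perm s A)) = row (s (lshift _ u)) A.
  by apply/rowP => l; rewrite !mxE.
have rD u : row u (@dsubmx _ 2 _ _ (row_perm s A)) = row (s (rshift 2 u)) A.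
  by apply/rowP => l; rewrite !mxE.
have [u su|v sv] := @split_ordP 2 (n * 2) (s^-1%g i).
  rewrite bA ?mulr0 ?mul0r // => [k|]; first by exists (s (lshift _ k)).
  by exists u; rewrite rU -su permKV.
rewrite [X in _ * X](IH _ v) ?mulr0 // => X XA [k Xk]; apply: bA => [l|].
  by have [l' ->] := XA l; exists (s (rshift 2 l')).
by exists k; rewrite Xk rD -sv permKV.
Qed.

(* Up to a constant, the Pfaffian of this bordered matrix is the density of a /\ b^n. *)
Lemma contact_bordered_det n d (a : 'M[R]_(1, d) -> R) (b : 'M[R]_(2, d) -> R)
    (av : 'cV[R]_d) (B : 'M[R]_d) (A0 : 'M[R]_(1 + n * 2, d)) :
  d = (1 + n * 2)%N -> (forall A, a A = (A *m av) 0 0) -> B^T = - B ->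
  (forall A, b A = (row 0 A *m B *m (row 1 A)^T) 0 0) ->
  wedge a (@wedge_exp R d b n) A0 != 0 ->
  \det (block_mx (0 : 'M[R]_1) av^T (- av) B) != 0.
Proof.
move=> dn; subst d => aE BT bE.
have aM : multilinear a.
  apply/multilinearP => X Y Z i x y; rewrite (ord1 i) => E _ _.
  have XE : X = x *: Y + y *: Z by apply/row_matrixP => k; rewrite (ord1 k) E linearD !linearZ.
  by rewrite !aE XE mulmxDl -!scalemxAl !mxE.
have bM : multilinear b.
  apply/multilinearP => X Y Z i x y; rewrite !bE.
  have [->|->] : i = 0 \/ i = 1.
    by case: i => [[|[|[]]] // lti]; [left|right]; exact: val_inj.
    move=> -> YX ZX; rewrite (YX 1) // (ZX 1) // !mulmxDl -!scalemxAl mxE.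
    by congr (_ + _); rewrite mxE.
  move=> -> YX ZX; rewrite (YX 0) // (ZX 0) // linearD !linearZ /= mulmxDr -!scalemxAr mxE.
  by congr (_ + _); rewrite mxE.
apply: contraNneq => /eqP /det0P[w w0 wK]; pose phi := wedge a (@wedge_exp R _ b n).
rewrite -/(phi A0) (@multilinear_det _ phi); last 2 first.
- by apply: wedge_multilinear => //; exact: wedge_exp_multilinear.
- exact: wedge_row_perm.
(* Since [phi] is a multiple of the determinant, a single basis on which it vanishes is enough. It
   will be adapted to the kernel vector [w]. *)
suff [C detC phiC] : exists2 C, \det C != 0 & phi C = 0.
  move: phiC; rewrite (@multilinear_det _ phi); last 2 first.
  - by apply: wedge_multilinear => //; exact: wedge_exp_multilinear.
  - exact: wedge_row_perm.
  by move=> /eqP; rewrite mulf_eq0 (negPf detC) /= => /eqP ->; rewrite mulr0.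
have [av0|av0] := eqVneq av 0.
  exists 1%:M; first by rewrite det1 oner_neq0.
  by rewrite /phi /wedge big1 ?mulr0 // => s _; rewrite aE av0 mulmx0 mxE mulr0 mul0r.
(* A kernel vector (c, Y) satisfies a(Y) = 0 and b(Y, .) = - c a, so Y is b-orthogonal to the whole
   kernel of [a]. *)
move: wK; rewrite -[w]hsubmxK mul_row_block mulmx0 add0r -[RHS]row_mx0.
move=> /eq_row_mx[/eqP]; rewrite mulmxN oppr_eq0 => /eqP.
set Y := rsubmx w; set c := lsubmx w => Yav YB.
have Y0 : Y != 0.
  apply: contraNneq w0 => Y0; move: YB; rewrite Y0 mul0mx addr0.
  rewrite -[w]hsubmxK -/Y -/c Y0 (mx11_scalar c) mul_scalar_mx => /eqP.
  rewrite scaler_eq0 trmx_eq0 (negPf av0) orbF => /eqP ->.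
  by rewrite raddf0 row_mx0.
have {YB} YB u : u *m av = 0 -> Y *m B *m u^T = 0.
  move=> uav; have /eqP := YB; rewrite addrC addr_eq0 => /eqP ->.
  by rewrite mulNmx -mulmxA -trmx_mul uav trmx0 mulmx0 oppr0.
have [i Yi] : exists i, Y 0 i != 0 by apply/rV0Pn.
(* U completes Y to a basis; subtracting multiples of row j of U makes every
   other row annihilate av, so that Y is b-orthogonal to all rows but row j. *)
pose U := \matrix_(k, l) if k == i then Y 0 l else (1%:M : 'M[R]_(1 + n * 2)) k l.
have detU : \det U = Y 0 i.
  have adj1 : \adj (1%:M : 'M[R]_(1 + n * 2)) = 1%:M.
    by rewrite -[LHS]mul1mx mul_mx_adj det1.
  have cofU l : cofactor U i l = (l == i)%:R.
    transitivity (cofactor (1%:M : 'M[R]_(1 + n * 2)) i l).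
      congr (_ * \det _); apply/matrixP => p q.
      by rewrite !mxE eq_sym (negPf (neq_lift _ _)).
    by have := congr1 (fun A : 'M[R]_(1 + n * 2) => A l i) adj1; rewrite !mxE.
  rewrite (expand_det_row _ i) (bigD1 i) //= big1 ?addr0 => [|l li].
    by rewrite cofU eqxx mulr1 mxE eqxx.
  by rewrite cofU (negPf li) mulr0.
have rowU : row i U = Y by apply/rowP => l; rewrite !mxE eqxx.
have Uu : U \in unitmx by rewrite unitmxE detU unitfE.
have [j Uj] : exists j, (U *m av) j 0 != 0.
  apply/cV0Pn; apply: contraNneq av0 => Uav.
  by rewrite -[av](mulKmx Uu) Uav mulmx0.
have rowUav k : row k U *m av = ((U *m av) k 0)%:M.
  by rewrite -row_mul; apply/rowP => l; rewrite (ord1 l) !mxE eqxx.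
have Ui : (U *m av) i 0 = 0.
  by have /matrixP/(_ 0 0) := rowUav i; rewrite rowU Yav mxE [RHS]mxE eqxx mulr1n => <-.
have ij : i != j by apply: contraNneq Uj => <-; rewrite Ui.
pose t : 'cV[R]_(1 + n * 2) :=
  \col_k (if k == j then 0 else (U *m av) k 0 / (U *m av) j 0).
pose C := U - t *m row j U.
have rowC k : row k C = row k U - t k 0 *: row j U.
  rewrite linearB /= row_mul; congr (_ - _).
  by rewrite (mx11_scalar (row k t)) mul_scalar_mx mxE.
have rowCi : row i C = Y.
  by rewrite rowC [t i 0]mxE (negPf ij) Ui mul0r scale0r subr0 rowU.
have Cav k : k != j -> row k C *m av = 0.
  move=> kj; rewrite rowC mulmxBl -scalemxAl !rowUav [t k 0]mxE (negPf kj).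
  by rewrite scale_scalar_mx divfK // subrr.
exists C.
  pose dl : 'rV[R]_(1 + n * 2) := delta_mx 0 j.
  have CE : C = (1%:M - t *m dl) *m U by rewrite mulmxBl mul1mx -mulmxA -rowE.
  have dt : dl *m t = 0.
    by rewrite -rowE; apply/rowP => l; rewrite !mxE eqxx.
  have T1 : (1%:M - t *m dl) *m (1%:M + t *m dl) = 1%:M.
    rewrite mulmxDr mulmx1 mulmxBl mul1mx -mulmxA (mulmxA dl) dt mul0mx mulmx0.
    by rewrite subr0 subrK.
  have := congr1 determinant T1; rewrite det1 det_mulmx CE det_mulmx detU => T1'.
  rewrite mulf_neq0 //; apply: contra_eq_neq T1' => ->.
  by rewrite mul0r eq_sym oner_neq0.
(* Either the row given to [a] is not row [j] and is killed by [a], or row [j] is used up and Y is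
   b-orthogonal to all the rows left for b^n. *)
rewrite /phi /wedge big1 ?mulr0 // => s _.
have rU (u : 'I_1) : row u (@usubmx _ 1 _ _ (row_perm s C)) = row (s (lshift _ u)) C.
  by apply/rowP => l; rewrite !mxE.
have rD u : row u (@dsubmx _ 1 _ _ (row_perm s C)) = row (s (rshift 1 u)) C.
  by apply/rowP => l; rewrite !mxE.
have [sj|sj] := eqVneq (s (lshift (n * 2) 0)) j; last first.
  rewrite aE; have -> : usubmx (row_perm s C) = row 0 (usubmx (row_perm s C)).
    by apply/row_matrixP => k; rewrite (ord1 k); apply/rowP => l; rewrite !mxE.
  by rewrite rU Cav // mxE mulr0 mul0r.
have [u su|v sv] := @split_ordP 1 (n * 2) (s^-1%g i).
  by move: ij; rewrite -sj -(ord1 u) -su permKV eqxx.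
have D0 l : row l (@dsubmx _ 1 _ _ (row_perm s C)) *m av = 0.
  by rewrite rD Cav // -sj (inj_eq perm_inj) eq_sym eq_lrshift.
rewrite (@wedge_exp_radical _ _ _ _ v) ?mulr0 // => X XA [k Xk].
have {Xk} Xk : row k X = Y by rewrite Xk rD -sv permKV.
have X0 l : row l X *m av = 0 by have [l' ->] := XA l.
rewrite bE; have [k0|k1] : k = 0 \/ k = 1.
    by case: k {Xk} => [[|[|[]]] // lti]; [left|right]; exact: val_inj.
  by rewrite -k0 Xk YB // mxE.
have -> : row 0 X *m B *m (row 1 X)^T = - (Y *m B *m (row 0 X)^T)^T.
  by rewrite -k1 Xk !trmx_mul trmxK BT mulNmx mulmxN opprK mulmxA.
by rewrite YB // trmx0 oppr0 mxE.
Qed.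

End Wedge.

(** * Tangent maps of toral manifolds *)

Section ToralCalculus.
Context {R : realType}.
Implicit Types M N K : toral R.

Lemma tor_projD M (x k : 'rV[R]_(tor_dim M)) :
  k \is a mxOver Num.int -> tor_proj M (x + k) = tor_proj M x.
Proof. by move=> kZ; apply/tor_projE; rewrite addrC addKr. Qed.

Lemma base_ptK M (p : M) : tor_proj M (base_pt p) = p.
Proof. exact: (getPex (tor_surj p)). Qed.

Lemma zperiodic_proj M (T : Type) (f : M -> T) :
  zperiodic (fun x => f (tor_proj M x)).
Proof. by move=> x k kZ; rewrite tor_projD. Qed.

(** Integer vectors at distance less than 1 coincide, so [G] is constant near [x]. This compares two
    lifts of one map, whose difference is integer-valued. *)
Lemma derive_int m n (G : 'rV[R]_m -> 'rV[R]_n) x v :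
  {for x, continuous G} -> (forall y, G y \is a mxOver Num.int) -> 'D_v G x = 0.
Proof.
move=> cG GZ; rewrite -(derive_cst (G x) x v); apply: near_eq_derive.
have /cvgrPdist_lt/(_ _ (ltr01))  := cG.
apply: filterS => y Gy; apply/rowP => j /=; apply/eqP; rewrite eq_sym -subr_eq0.
have dZ : G x 0 j - G y 0 j \is a Num.int.
  by apply: rpredB; [have /mxOverP := GZ x|have /mxOverP := GZ y]; exact.
have : `|G x 0 j - G y 0 j| < 1.
  apply: le_lt_trans Gy; rewrite [leRHS]/Num.Def.normr /= mx_normrE.
  by have := le_bigmax (0 : R) (fun i : 'I_1 * 'I_n => `|(G x - G y) i.1 i.2|) (0, j); rewrite !mxE.
by apply: contraTT => d0; rewrite -leNgt; exact: norm_intr_ge1.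
Qed.

Lemma derive_translate m (W : normedModType R) (G : 'rV[R]_m -> W) x k v :
  'D_v (fun y => G (y + k)) x = 'D_v G (x + k).
Proof.
rewrite /derive; suff -> :
  (fun h => h^-1 *: (((fun y => G (y + k)) \o shift x) (h *: v) - G (x + k))) =
  (fun h => h^-1 *: ((G \o shift (x + k)) (h *: v) - G (x + k))) by [].
by apply/funext => h /=; rewrite addrA.
Qed.

Definition C1_map M N (f : M -> N) := exists G, is_lift f G /\ Ck 1 G.

Lemma C1_liftP M N (f : M -> N) : C1_map f -> is_lift f (C1_lift f) /\ Ck 1 (C1_lift f).
Proof. by move=> H; exact: (getPex H). Qed.

Lemma tangentE M N (f : M -> N) G x v :
  is_lift f G -> Ck 1 G -> v *m tangent f (tor_proj M x) = 'D_v G x.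
Proof.
move=> fG CG; have [fL [dL DL]] : is_lift f (C1_lift f) /\ Ck 1 (C1_lift f).
  by apply: C1_liftP; exists G.
rewrite /tangent -deriveEjacobian; last exact: dL.
have [dG _] := CG; set k := base_pt (tor_proj M x) - x.
have kZ : k \is a mxOver Num.int by apply/tor_projE; rewrite base_ptK.
have -> : base_pt (tor_proj M x) = x + k by rewrite addrC subrK.
rewrite -derive_translate; apply/eqP; rewrite -subr_eq0; apply/eqP.
have dLk : differentiable (fun y => C1_lift f (y + k)) x.
  apply: (@differentiable_comp _ _ _ _ (fun y => y + k)); last exact: dL.
  have di : differentiable (@id 'rV[R]_(tor_dim M)) x by [].
  exact: (differentiableD di (differentiable_cst k x)).
rewrite -deriveB; [|exact: diff_derivable|exact: diff_derivable].
apply: derive_int => [|y].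
  by apply: differentiable_continuous; exact: differentiableB.
by apply/tor_projE; rewrite -fL -fG tor_projD.
Qed.

Lemma Ck1_comp m n (W : normedModType R) (G : 'rV[R]_m -> 'rV[R]_n) (H : 'rV[R]_n -> W) :
  Ck 1 G -> Ck 1 H -> Ck 1 (H \o G).
Proof.
move=> [dG DG] [dH DH]; split=> [x|v]; first exact: differentiable_comp.
rewrite [X in Ck _ X](_ : _ =
    fun x => \sum_i 'D_v G x 0 i *: 'D_(delta_mx 0 i) H (G x)); last first.
  apply/funext => x; rewrite deriveE; last exact: differentiable_comp.
  rewrite diff_comp // /= -(deriveE v (dG x)).
  rewrite {1}[ 'D_v G x]row_sum_delta linear_sum /=.
  by apply: eq_bigr => i _; rewrite linearZ /= (deriveE _ (dH (G x))).
apply: (@Ck_sum _ _ _ _ _ _ 0) => i _ x.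
have c1 : {for x, continuous (fun y => 'D_v G y 0 i : R^o)}.
  apply: (@continuous_comp _ _ _ ('D_v G) (fun z : 'rV[R]_n => z 0 i : R^o)).
    exact: DG.
  exact: coord_continuous.
have c2 : {for x, continuous (fun y => 'D_(delta_mx 0 i) H (G y))}.
  apply: (@continuous_comp _ _ _ G ('D_(delta_mx 0 i) H)); last exact: DH.
  exact: differentiable_continuous.
exact: cvgZ c1 c2.
Qed.

Lemma is_lift_comp M N K (f : M -> N) (h : N -> K) G H :
  is_lift f G -> is_lift h H -> is_lift (h \o f) (H \o G).
Proof. by move=> fG hH x; rewrite /= fG hH. Qed.

Lemma C1_map_comp M N K (f : M -> N) (h : N -> K) :
  C1_map f -> C1_map h -> C1_map (h \o f).
Proof.
move=> [G [fG CG]] [H [hH CH]]; exists (H \o G).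
by split; [exact: is_lift_comp|exact: Ck1_comp].
Qed.

Lemma tangent_comp M N K (f : M -> N) (h : N -> K) p :
  C1_map f -> C1_map h -> tangent (h \o f) p = tangent f p *m tangent h (f p).
Proof.
move=> [G [fG CG]] [H [hH CH]]; have [x <-] := tor_surj p.
apply/row_matrixP => i; rewrite !rowE mulmxA.
rewrite (tangentE _ _ (is_lift_comp fG hH) (Ck1_comp CG CH)).
rewrite (tangentE _ _ fG CG) fG (tangentE _ _ hH CH).
have [dG _] := CG; have [dH _] := CH.
rewrite deriveE; last exact: differentiable_comp.
by rewrite diff_comp // /= -deriveE // -deriveE.
Qed.

Lemma Ck1_id m : Ck 1 (@id 'rV[R]_m).
Proof.
split=> [x|v] //.
rewrite (_ : (fun x => _) = fun=> v); first exact: cst_continuous.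
by apply/funext => x; rewrite derive_id.
Qed.

Lemma C1_map_id M : C1_map (@id M).
Proof. by exists id; split=> //; exact: Ck1_id. Qed.

Lemma tangent_id M (p : M) : tangent id p = 1%:M.
Proof.
have [x <-] := tor_surj p; apply/row_matrixP => i; rewrite !rowE mulmx1.
by rewrite (@tangentE _ _ _ id) ?derive_id //; exact: Ck1_id.
Qed.

Lemma C1_map_iter M (f : M -> M) n : C1_map f -> C1_map (iter n f).
Proof.
move=> Cf; elim: n => [|n IH]; first exact: C1_map_id.
exact: (C1_map_comp IH Cf).
Qed.

Lemma tangent_iterS M (f : M -> M) n p : C1_map f ->
  tangent (iter n.+1 f) p = tangent f p *m tangent (iter n f) (f p).
Proof.
move=> Cf; have -> : iter n.+1 f = iter n f \o f.
  by apply/funext => q; rewrite iterSr.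
by rewrite tangent_comp //; exact: C1_map_iter.
Qed.

Lemma Cr_C1_map r M N (f : M -> N) : reg_le (Some 1%N) r -> Cr r f -> C1_map f.
Proof. by move=> r1 [G fG CG]; exists G; split=> //; exact: CG. Qed.

End ToralCalculus.

(** * Hyperbolicity *)

Section Hyperbolic.
Context {R : realType}.
Implicit Types M : toral R.

(** Coordinate [j] is the inner product with row [j] of g^-1. By Cauchy-Schwarz the constant is the
    square root of the diagonal entry (g^-1)_jj, which is periodic and continuous, hence bounded. *)
Lemma coord_le_rnorm M (g : M -> 'M[R]_(tor_dim M)) : riemannian g ->
  exists2 C, 0 < C & forall p (v : 'rV[R]_(tor_dim M)) j, `|v 0 j| <= C * rnorm g p v.
Proof.
move=> [gT gpos gsm].
have gdet p : \det (g p) != 0.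
  apply/det0P => -[v v0 vg]; have := gpos p v v0.
  by rewrite vg mul0mx mxE ltxx.
have gu p : g p \in unitmx by rewrite unitmxE unitfE gdet.
have bnd j : exists2 C, 0 < C & forall p, `|invmx (g p) j j| <= C.
  have cg : continuous (fun x => invmx (g (tor_proj M x)) j j : R^o).
    apply: (@Ck_invmx R _ 0 _ (fun x => g (tor_proj M x))) => // a b.
    exact: (gsm a b 0%N).
  have [C C0 HC] := periodic_bounded cg (@zperiodic_proj _ M _ (fun p => invmx (g p) j j : R^o)).
  by exists C => // p; have [x <-] := tor_surj p; exact: HC.
have [C HC] := choice (fun j => let: ex_intro2 C C0 CP := bnd j in ex_intro _ C (conj C0 CP)).
exists (1 + \sum_j Num.sqrt (C j)) => [|p v j].
  by rewrite ltr_pwDl // sumr_ge0 // => j _; exact: sqrtr_ge0.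
pose B (u w : 'rV[R]_(tor_dim M)) := (u *m g p *m w^T) 0 0.
have Bv0 u : 0 <= B u u.
  have [->|u0] := eqVneq u 0; first by rewrite /B !mul0mx mxE.
  exact/ltW/gpos.
pose w := delta_mx 0 j *m invmx (g p) : 'rV[R]_(tor_dim M).
have wg : w *m g p = delta_mx 0 j by rewrite mulmxKV.
have Bwu u : B w u = u 0 j by rewrite /B wg -rowE !mxE.
have Buw u : B u w = u 0 j.
  rewrite -Bwu /B -[in LHS](gT p).
  have -> : u *m (g p)^T *m w^T = (w *m g p *m u^T)^T by rewrite !trmx_mul trmxK mulmxA.
  by rewrite mxE.
have Bww : B w w = invmx (g p) j j by rewrite Bwu /w -rowE mxE.
have Bww0 : 0 < B w w.
  apply: gpos; apply: contra_eq_neq wg => ->; rewrite mul0mx eq_sym.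
  by apply/eqP => /matrixP/(_ 0 j)/eqP; rewrite !mxE !eqxx oner_eq0.
have CS : (v 0 j) ^+ 2 <= B w w * B v v.
  have := Bv0 (B w w *: v - v 0 j *: w).
  have -> : B (B w w *: v - v 0 j *: w) (B w w *: v - v 0 j *: w) =
      B w w * (B w w * B v v - (v 0 j) ^+ 2).
    have BZl c u z : B (c *: u) z = c * B u z by rewrite /B -!scalemxAl mxE.
    have BDl u u' z : B (u + u') z = B u z + B u' z by rewrite /B !mulmxDl mxE.
    have BZr c u z : B u (c *: z) = c * B u z by rewrite /B linearZ -scalemxAr mxE.
    have BDr u z z' : B u (z + z') = B u z + B u z' by rewrite /B linearD mulmxDr mxE.
    rewrite -[- (v 0 j *: w)]scaleNr BDl !BDr !BZl !BZr (Buw v) (Bwu v).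
    move: (B v v) (v 0 j) (B w w) => x y z; ring.
  by rewrite pmulr_rge0 // subr_ge0.
rewrite /rnorm -/(B v v) -sqrtr_sqr (le_trans (ler_wsqrtr CS)) //.
rewrite sqrtrM ?Bv0 // ler_wpM2r ?sqrtr_ge0 //.
apply: (@le_trans _ _ (Num.sqrt (C j))).
  by rewrite ler_wsqrtr // Bww (le_trans (ler_norm _)) // (HC j).2.
rewrite (bigD1 j) //= addrCA lerDl addr_ge0 // sumr_ge0 // => k _; exact: sqrtr_ge0.
Qed.

(** Invariance lets [psi] be evaluated at the n-th iterate, where the vector has been contracted,
    and the bound of positive degree tends to 0. Contraction takes place on the base [M], but the
    quantity lives over a space [T] fibred above it, here the product. It is not assumed linear,
    since it will be a weighted power of a covector. *)
Lemma contracted_invariant_eq0 M (T : Type) (f : M -> M) (F : T -> T) (pr : T -> M)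
    g (E : M -> 'M[R]_(tor_dim M)) (C lambda D : R) (e : nat)
    (psi : T -> 'rV[R]_(tor_dim M) -> R) :
  C1_map f -> (forall t, pr (F t) = f (pr t)) -> 0 <= D ->
  0 < lambda < 1 -> contracts g f E C lambda ->
  (forall t v, psi (F t) (v *m tangent f (pr t)) = psi t v) ->
  (forall t v, `|psi t v| <= D * rnorm g (pr t) v ^+ e.+1) ->
  forall t v, (v <= E (pr t))%MS -> psi t v = 0.
Proof.
move=> Cf prF D0 /andP[l0 l1] ctr inv bd t v vE.
have iterE n s u : psi (iter n F s) (u *m tangent (iter n f) (pr s)) = psi s u.
  elim: n s u => [|n IH] s u; first by rewrite /= tangent_id mulmx1.
  by rewrite iterSr tangent_iterS // mulmxA -prF IH inv.
have pri n : pr (iter n F t) = iter n f (pr t).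
  by elim: n => //= n IH; rewrite prF IH.

pose u n := D * (C * lambda ^+ n * rnorm g (pr t) v) ^+ e.+1.
have bu n : `|psi t v| <= u n.
  rewrite -(iterE n) (le_trans (bd _ _)) // ler_wpM2l // pri.
  by rewrite lerXn2r ?nnegrE ?sqrtr_ge0 // ?(le_trans _ (ctr _ _ n vE)) ?sqrtr_ge0 // ctr.
have u0 : u @ \oo --> (0 : R).
  have ul : (fun n => C * lambda ^+ n * rnorm g (pr t) v) @ \oo --> (0 : R).
    have lam : (fun n => lambda ^+ n) @ \oo --> (0 : R).
      by apply: cvg_expr; rewrite gtr0_norm.
    have := cvgM (cvgM (@cvg_cst _ C _ \oo _) lam) (@cvg_cst _ (rnorm g (pr t) v) _ \oo _).
    by rewrite mulr0 mul0r; apply.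
  have ue : (fun n => (C * lambda ^+ n * rnorm g (pr t) v) ^+ e.+1) @ \oo --> (0 ^+ e.+1 : R).
    exact: (cvg_comp _ _ ul (@exprn_continuous R e.+1 0)).
  have := cvgM (@cvg_cst _ D _ \oo _) ue.
  by rewrite expr0n mulr0; apply.
apply/eqP; rewrite -normr_le0.
have cu : cvg (u @ \oo) by apply/cvg_ex; exists 0.
by rewrite -(cvg_lim _ u0) //; apply: limr_ge => //; near=> n; exact: bu.
Unshelve. all: by end_near.
Qed.

End Hyperbolic.

Section AnosovCovector.
Context {R : realType}.

(* The weight k and the exponent let an invariant density stand for the root of
   it by which th would have to be rescaled in order to become invariant. *)
Lemma anosov_covector_eq0 (M : toral R) (f finv : M -> M) (T : Type) (F Finv : T -> T)
    (pr : T -> M) (k : T -> R) (th : T -> 'cV[R]_(tor_dim M)) (e : nat) (D1 D2 : R) :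
  C1_map f -> C1_map finv -> cancel f finv -> cancel finv f -> anosov f ->
  cancel Finv F -> (forall t, pr (F t) = f (pr t)) ->
  (forall t, k t != 0) ->
  (forall t (v : 'rV[R]_(tor_dim M)), k (F t) * (v *m tangent f (pr t) *m th (F t)) 0 0 ^+ e.+1 =
    k t * (v *m th t) 0 0 ^+ e.+1) ->
  (forall t, `|k t| <= D1) -> (forall t j, `|th t j 0| <= D2) ->
  forall t, th t = 0.
Proof.
move=> Cf Cfinv fK finvK [finv' [g [Es [Eu [[f'K finv'K] gR full [Esf Euf]]]]]].
move=> [C [lambda [C0 l01 cs cu]]] FinvK prF k0 inv kD thD t.
have fE : finv' = finv by apply/funext => q; rewrite -{2}(finv'K q) fK.
move: cu; rewrite {}fE {f'K finv'K finv'} => cu.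
pose psi s (v : 'rV[R]_(tor_dim M)) := k s * (v *m th s) 0 0 ^+ e.+1.
have D10 : 0 <= D1 by exact: le_trans (normr_ge0 _) (kD t).
have [C' C'0 HC'] := coord_le_rnorm gR.
(* In dimension 0 nothing forces [D2] to be nonnegative, hence the absolute value. *)
pose D := D1 * (\sum_(j < tor_dim M) C' * `|D2|) ^+ e.+1.
have D0 : 0 <= D.
  by rewrite mulr_ge0 // exprn_ge0 // sumr_ge0 // => j _; rewrite mulr_ge0 // ltW.
have bd s v : `|psi s v| <= D * rnorm g (pr s) v ^+ e.+1.
  rewrite normrM normrX /D -mulrA -exprMn ler_pM //.
  rewrite lerXn2r ?nnegrE // ?mulr_ge0 ?sqrtr_ge0 //.
    by rewrite sumr_ge0 // => j _; rewrite mulr_ge0 // ltW.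
  rewrite mxE (le_trans (ler_norm_sum _ _ _)) // mulr_suml ler_sum // => j _.
  by rewrite normrM mulrAC ler_pM // (le_trans (thD s j)) // ler_norm.
have prFinv s : pr (Finv s) = finv (pr s).
  by rewrite -{2}(FinvK s) prF fK.
have psiinv s v : psi (Finv s) (v *m tangent finv (pr s)) = psi s v.
  rewrite /psi -inv FinvK prFinv -(mulmxA v) -[X in tangent f X](prFinv s).
  have -> : tangent finv (pr s) *m tangent f (pr (Finv s)) = 1%:M.
    rewrite prFinv -tangent_comp // -(tangent_id (pr s)); congr (tangent _ _).
    by apply/funext => q /=; rewrite finvK.
  by rewrite mulmx1.
have psis v : (v <= Es (pr t))%MS -> psi t v = 0.
  exact: (contracted_invariant_eq0 Cf prF D0 l01 cs inv bd).
have psiu v : (v <= Eu (pr t))%MS -> psi t v = 0.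
  exact: (contracted_invariant_eq0 Cfinv prFinv D0 l01 cu psiinv bd).
have ths v : psi t v = 0 -> v *m th t = 0.
  move=> /eqP; rewrite mulf_eq0 (negPf (k0 t)) expf_eq0 /= => /eqP H.
  by rewrite (mx11_scalar (v *m th t)) H raddf0.
have [fu _] := full (pr t).
apply/row_matrixP => i; rewrite row0 rowE.
have sub : ((delta_mx 0 i : 'rV[R]_(tor_dim M)) <= Es (pr t) + Eu (pr t))%MS.
  exact: submx_full.
have [u ->] := sub_addsmxP sub; rewrite mulmxDl.
by rewrite (ths _ (psis _ (submxMl _ _))) (ths _ (psiu _ (submxMl _ _))) addr0.
Qed.

End AnosovCovector.

(** * Skew-products *)

Section RowMaps.
Context {R : realType}.

Lemma Ck_scale_vec (U W : normedModType R) k (c : U -> R^o) (w : W) :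
  Ck k c -> Ck k (fun x => c x *: w).
Proof.
elim: k c => [|k IH] c; first by move=> cc x; exact: cvgZ (cc x) (@cvg_cst _ w _ _ _).
move=> [dc Dc]; split=> [x|v]; first exact: differentiableZl.
rewrite [X in Ck _ X](_ : _ = fun x => 'D_v c x *: w); first exact: IH (Dc v).
apply/funext => x; rewrite deriveE; last exact: differentiableZl.
by rewrite diffZl //= (deriveE v (dc x)).
Qed.

Lemma Ck_row (U : normedModType R) n k (G : U -> 'rV[R]_n) :
  (forall j, Ck k (fun x => G x 0 j : R^o)) -> Ck k G.
Proof.
move=> CG; rewrite (_ : G = fun x => \sum_j G x 0 j *: delta_mx 0 j).
  by apply: Ck_sum => j _; exact: Ck_scale_vec.
by apply/funext => x; exact: row_sum_delta.
Qed.

Lemma derive_coord (U : normedModType R) n (G : U -> 'rV[R]_n) x v j :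
  derivable G x v -> 'D_v (fun y => G y 0 j : R^o) x = 'D_v G x 0 j.
Proof. by move=> /derive_mx ->; rewrite mxE. Qed.

Lemma Ck1_coord (U : normedModType R) n (G : U -> 'rV[R]_n) j :
  Ck 1 G -> Ck 1 (fun x => G x 0 j : R^o).
Proof.
move=> [dG DG]; split=> [x|v].
  apply: (@differentiable_comp _ _ _ _ G (fun z : 'rV[R]_n => z 0 j : R^o)) => //.
  exact: differentiable_coord.
rewrite [X in Ck _ X](_ : _ = fun x => 'D_v G x 0 j : R^o).
  move=> x; apply: (@continuous_comp _ _ _ ('D_v G) (fun z : 'rV[R]_n => z 0 j : R^o)).
    exact: DG.
  exact: coord_continuous.
by apply/funext => x; apply: derive_coord; exact: diff_derivable.
Qed.

Lemma Ck1_lsubmx m n (W : normedModType R) (H : 'rV[R]_m -> W) :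
  Ck 1 H -> Ck 1 (fun x : 'rV[R]_(m + n) => H (lsubmx x)).
Proof.
move=> CH; apply: (@Ck1_comp _ _ _ _ (@lsubmx R 1 m n)) => //.
apply: Ck_row => j; rewrite [X in Ck _ X](_ : _ = fun x : 'rV[R]_(m + n) => x 0 (lshift n j) : R^o).
  exact: (@Ck1_coord _ _ id _ (@Ck1_id _ _)).
by apply/funext => x; rewrite mxE.
Qed.

Lemma derive_lsubmx m n (W : normedModType R) (H : 'rV[R]_m -> W)
    (x v : 'rV[R]_(m + n)) :
  'D_v (fun y => H (lsubmx y)) x = 'D_(lsubmx v) H (lsubmx x).
Proof.
rewrite /derive; suff -> : (fun h => h^-1 *: (((fun y => H (lsubmx y)) \o shift x) (h *: v)
    - H (lsubmx x))) = (fun h => h^-1 *: ((H \o shift (lsubmx x)) (h *: lsubmx v)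
    - H (lsubmx x))) by [].
apply/funext => h /=; congr (_ *: (H _ - _)).
by apply/rowP => j; rewrite !mxE.
Qed.

End RowMaps.

Section SkewTangent.
Context {R : realType} (M : toral R) (f : M -> M) (gamma : M -> circle R).
Hypotheses (Cf : C1_map f) (Cgamma : C1_map gamma).
Local Notation F := (skew_product f gamma).

Lemma torus_projD m (x y : 'rV[R]_m) : torus_proj (x + y) = torus_proj x + torus_proj y.
Proof. by rewrite /torus_proj !piE. Qed.

Lemma skew_lift : exists2 G, is_lift F G /\ Ck 1 G &
  forall x v, 'D_v G x = row_mx (lsubmx v *m tangent f (tor_proj M (lsubmx x)))
    (rsubmx v + lsubmx v *m tangent gamma (tor_proj M (lsubmx x))).
Proof.
have [fh [fL Cfh]] := Cf; have [gh [gL Cgh]] := Cgamma.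
pose G (x : 'rV[R]_(tor_dim M + 1)) := row_mx (fh (lsubmx x)) (rsubmx x + gh (lsubmx x)).
have GL : is_lift F G.
  move=> x; rewrite /skew_product /= /prod_proj /G row_mxKl row_mxKr fL /=.
  by rewrite torus_projD gL.
have CG : Ck 1 G.
  apply: Ck_row => j; rewrite /G; case: (split_ordP j) => k ->.
    rewrite [X in Ck _ X](_ : _ = fun x : 'rV[R]_(tor_dim M + 1) => fh (lsubmx x) 0 k : R^o).
      exact/Ck1_coord/Ck1_lsubmx.
    by apply/funext => x; rewrite row_mxEl.
  rewrite [X in Ck _ X](_ : _ = fun x : 'rV[R]_(tor_dim M + 1) =>
      x 0 (rshift _ k) + gh (lsubmx x) 0 k : R^o).
    apply: CkD; first exact: (@Ck1_coord _ _ _ id _ (@Ck1_id _ _)).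
    exact/Ck1_coord/Ck1_lsubmx.
  by apply/funext => x; rewrite row_mxEr !mxE.
exists G => // x v; rewrite (tangentE _ _ fL Cfh) (tangentE _ _ gL Cgh).
have dG : derivable G x v by apply: diff_derivable; have [+ _] := CG; exact.
have der (W : normedModType R) (H : 'rV[R]_(tor_dim M) -> W) : Ck 1 H ->
    derivable (fun y : 'rV[R]_(tor_dim M + 1) => H (lsubmx y)) x v.
  by move=> CH; apply: diff_derivable; have [+ _] := Ck1_lsubmx 1 CH; exact.
apply/rowP => j; rewrite -derive_coord // /G; case: (split_ordP j) => k ->.
  rewrite row_mxEl -derive_lsubmx -derive_coord; last exact: der.
  by congr (derive _ x v); apply/funext => y; rewrite row_mxEl.
rewrite row_mxEr mxE -derive_lsubmx -derive_coord; last exact: der.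
have idk : 'D_v (fun y : 'rV[R]_(tor_dim M + 1) => y 0 (rshift (tor_dim M) k) : R^o) x
    = rsubmx v 0 k.
  rewrite (@derive_coord _ _ _ id x v _ (@derivable_id _ _ x v)) derive_id.
  by rewrite mxE.
have C1 : Ck 1 (fun y : 'rV[R]_(tor_dim M + 1) => y 0 (rshift (tor_dim M) k) : R^o).
  exact: (@Ck1_coord _ _ _ id _ (@Ck1_id _ _)).
have C2 : Ck 1 (fun y : 'rV[R]_(tor_dim M + 1) => gh (lsubmx y) 0 k : R^o).
  exact/Ck1_coord/Ck1_lsubmx.
rewrite -[in RHS]idk -[RHS](deriveD
  (f := fun y : 'rV[R]_(tor_dim M + 1) => y 0 (rshift (tor_dim M) k) : R^o)
  (g := fun y : 'rV[R]_(tor_dim M + 1) => gh (lsubmx y) 0 k : R^o)).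
- by congr (derive _ x v); apply/funext => y; rewrite row_mxEr mxE mxE.
- by apply: diff_derivable; case: C1 => + _; exact.
- by apply: diff_derivable; case: C2 => + _; exact.
Qed.

Lemma skew_tangent (p : M * circle R) (v : 'rV[R]_(tor_dim M + 1)) :
  v *m tangent F p = row_mx (lsubmx v *m tangent f p.1)
    (rsubmx v + lsubmx v *m tangent gamma p.1).
Proof.
have [x <-] := tor_surj p; have [G [GL CG] GD] := skew_lift.
by rewrite (tangentE _ _ GL CG) GD.
Qed.

Lemma skew_tangent_block (p : M * circle R) :
  tangent F p = block_mx (tangent f p.1) (tangent gamma p.1) 0 1%:M.
Proof.
apply/row_matrixP => i; rewrite rowE skew_tangent.
rewrite rowE -[delta_mx 0 i in RHS]hsubmxK mul_row_block.
by rewrite mulmx0 addr0 mulmx1 addrC.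
Qed.

End SkewTangent.

(** * 1-forms on toral manifolds *)

Section OneForm.
Context {R : realType} (N : toral R).
Local Notation d := (tor_dim N).
Implicit Types (x v : 'rV[R]_(tor_dim N)).

Lemma periodic_base_pt (T : Type) (h : 'rV[R]_d -> T) x :
  zperiodic h -> h (base_pt (tor_proj N x)) = h x.
Proof.
move=> ph; rewrite -[base_pt _](subrK x) addrC ph //.
by apply/tor_projE; rewrite base_ptK.
Qed.

Lemma derive_dir (h : 'rV[R]_d -> R^o) x v : differentiable h x ->
  'D_v h x = \sum_i v 0 i * 'D_(delta_mx 0 i) h x.
Proof.
move=> dh; rewrite deriveE // {1}[v]row_sum_delta linear_sum /=.
by apply: eq_bigr => i _; rewrite linearZ /= (deriveE _ dh).
Qed.

Variables (a : N -> 'M[R]_(1, d) -> R) (a_form : diff_form a).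

Definition covec p : 'cV[R]_d := \col_j a p (delta_mx 0 j).

Lemma covecE p A : a p A = (A *m covec p) 0 0.
Proof.
have [aM _ _] := a_form; have {}aM := (multilinearP _).1 (aM p).
have a2 (b c : R) u v : a p (b *: u + c *: v) = b * a p u + c * a p v.
  apply: (aM _ _ _ 0); last 2 first; try by move=> j; rewrite (ord1 j) eqxx.
  by rewrite linearD !linearZ.
rewrite mxE {1}[A]row_sum_delta; under [RHS]eq_bigr do rewrite mxE.
elim/big_ind2: _ => [|s1 t1 s2 t2 <- <-|j _].
- by have := a2 0 0 0 0; rewrite !scale0r !mul0r !addr0.
- by have := a2 1 1 s1 s2; rewrite !scale1r !mul1r.
- by have := a2 (A 0 j) 0 (delta_mx 0 j) 0; rewrite scale0r mul0r !addr0.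
Qed.

Definition acoef j x : R^o := covec (tor_proj N x) j 0.

Lemma Ck_acoef k j : Ck k (acoef j).
Proof.
have [_ _ aS] := a_form; have := aS (delta_mx 0 j) k.
by congr Ck; apply/funext => x; rewrite /acoef mxE.
Qed.

Lemma zperiodic_acoef j : zperiodic (acoef j).
Proof. exact: (@zperiodic_proj _ N _ (fun p => covec p j 0)). Qed.

Lemma differentiable_acoef j x : differentiable (acoef j) x.
Proof. by have [+ _] := Ck_acoef 1 j; exact. Qed.

Definition dform x : 'M[R]_d :=
  \matrix_(i, j) ('D_(delta_mx 0 i) (acoef j) x - 'D_(delta_mx 0 j) (acoef i) x).

Lemma dform_tr x : (dform x)^T = - dform x.
Proof. by apply/matrixP => i j; rewrite !mxE opprB. Qed.

Lemma zperiodic_dform : zperiodic dform.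
Proof.
move=> x k kZ; apply/matrixP => i j; rewrite !mxE.
by rewrite !(zperiodic_derive _ (@zperiodic_acoef _) _ kZ).
Qed.

Lemma Ck_dform k i j : Ck k (fun x => dform x i j : R^o).
Proof.
rewrite [X in Ck _ X](_ : _ = fun x : 'rV[R]_d =>
  'D_(delta_mx 0 i) (acoef j) x - 'D_(delta_mx 0 j) (acoef i) x : R^o).
  by apply: CkB; [have [_ +] := Ck_acoef k.+1 j|have [_ +] := Ck_acoef k.+1 i]; exact.
by apply/funext => x; rewrite mxE.
Qed.

Lemma derive_form u v x :
  'D_u (fun y => a (tor_proj N y) v : R^o) x =
  \sum_i \sum_j u 0 i * v 0 j * 'D_(delta_mx 0 i) (acoef j) x.
Proof.
have D w : is_derive x w (fun y => a (tor_proj N y) v : R^o)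
    (\sum_j v 0 j * 'D_w (acoef j) x).
  rewrite [X in is_derive _ _ X](_ : _ = fun y => \sum_j v 0 j * acoef j y : R^o).
    apply: is_derive_bigsum => j _; apply: is_derive_mulcl.
    exact/derivableP/diff_derivable/differentiable_acoef.
  by apply/funext => y; rewrite covecE mxE.
have [_ ->] := D u; rewrite exchange_big /=; apply: eq_bigr => j _.
rewrite (derive_dir _ (differentiable_acoef j x)) mulr_sumr.
by apply: eq_bigr => i _; ring.
Qed.

Lemma ext_dE p (A : 'M[R]_(2, d)) :
  ext_d a p A = (row 0 A *m dform (base_pt p) *m (row 1 A)^T) 0 0.
Proof.
have r0 : row' 0 A = row 1 A.
  by apply/rowP => j; rewrite !mxE; congr (A _ _); exact: val_inj.
have r1 : row' 1 A = row 0 A.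
  by apply/rowP => j; rewrite !mxE; congr (A _ _); exact: val_inj.
rewrite /ext_d big_ord_recl big_ord1.
have -> : lift ord0 ord0 = 1 :> 'I_2 by exact: val_inj.
rewrite expr0 mul1r expr1 mulN1r r0 r1 !derive_form.
transitivity (\sum_i \sum_j row 0 A 0 i * dform (base_pt p) i j * row 1 A 0 j).
  rewrite [X in _ - X]exchange_big /= -sumrB; apply: eq_bigr => i _.
  by rewrite -sumrB; apply: eq_bigr => j _; rewrite [dform _ _ _]mxE; ring.
rewrite exchange_big [RHS]mxE; apply: eq_bigr => j _.
rewrite [(row 0 A *m _) _ _]mxE mulr_suml; apply: eq_bigr => i _.
by rewrite [_^T _ _]mxE.
Qed.

End OneForm.

(** * Conformal pullback of a 1-form by a map of class C^1 *)

Section PullbackForm.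
Context {R : realType} (N : toral R).
Local Notation d := (tor_dim N).
Variables (a : N -> 'M[R]_(1, d) -> R) (a_form : diff_form a).
Variables (F : N -> N) (G : 'rV[R]_d -> 'rV[R]_d) (tau : N -> R).
Hypotheses (FG : is_lift F G) (CG : Ck 1 G) (tauS : smooth tau).
Hypothesis tau_neq0 : forall p, tau p != 0.
Hypothesis Fa : forall p, tangent F p *m covec a (F p) = tau p *: covec a p.

Let t x : R^o := tau (tor_proj N x).
Let dt x : 'cV[R]_d := \col_i 'D_(delta_mx 0 i) t x.

(** This is [F]^* da = d(tau a) = tau da + dtau /\ a. With [F] only of class C^1, it rests on
    [exterior_chain], whose differentiability assumptions hold because the components of [F]^* a are
    those of the smooth form tau a. *)
Lemma pullback_dform x :
  tangent F (tor_proj N x) *m dform a (G x) *m (tangent F (tor_proj N x))^T =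
  tau (tor_proj N x) *: dform a x
  + (dt x *m (covec a (tor_proj N x))^T - covec a (tor_proj N x) *m (dt x)^T).
Proof.
set J := tangent F _; apply/matrixP => i j.
have [dG DG] := CG.
pose g l y : R^o := G y 0 l.
pose b l y : R^o := acoef a l (G y).
pose B : 'M[R]_d := \matrix_(k, l) 'D_(delta_mx 0 k) (acoef a l) (G x).
have Cg l : Ck 1 (g l) by exact: Ck1_coord.
have gJ w l y : 'D_w (g l) y = (w *m tangent F (tor_proj N y)) 0 l.
  by rewrite (tangentE _ _ FG CG) derive_coord //; exact: diff_derivable.
have db l : differentiable (b l) x.
  apply: (@differentiable_comp _ _ _ _ G (acoef a l)) => //.
  exact: differentiable_acoef.
have bB l w : 'D_w (b l) x = \sum_k B k l * 'D_w (g k) x.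
  have da : differentiable (acoef a l) (G x) by exact: differentiable_acoef.
  rewrite deriveE //.
  rewrite (@diff_comp _ _ _ _ G (acoef a l)) //= -(deriveE w (dG x)) -(deriveE _ da).
  rewrite derive_dir //; apply: eq_bigr => k _.
  rewrite mulrC [B k l]mxE; congr (_ * _); apply/esym/derive_coord.
  exact: diff_derivable.
pose H w := fun y => \sum_l b l y * 'D_w (g l) y : R^o.
have HE k : H (delta_mx 0 k) = fun y => t y * acoef a k y : R^o.
  apply/funext => y; have /matrixP/(_ k 0) := Fa (tor_proj N y).
  rewrite !mxE => /esym E; rewrite /acoef [covec _ _ _ _]mxE E.
  apply: eq_bigr => l _; rewrite gJ -rowE [row _ _ _ _]mxE mulrC /b /acoef FG //.
have dt1 y : differentiable t y by have [+ _] := tauS 1%N; exact.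
have tD w : is_derive x w t ('D_w t x) by apply: derivableP; exact: diff_derivable.
have aD w k : is_derive x w (acoef a k) ('D_w (acoef a k) x).
  by apply: derivableP; apply: diff_derivable; exact: differentiable_acoef.
have dH k : differentiable (H (delta_mx 0 k)) x.
  rewrite HE; apply: differentiableM => //; exact: differentiable_acoef.
have gJx k l : 'D_(delta_mx 0 k) (g l) x = J k l.
  by rewrite gJ -rowE mxE.
have EC : 'D_(delta_mx 0 i) (H (delta_mx 0 j)) x - 'D_(delta_mx 0 j) (H (delta_mx 0 i)) x =
    \sum_k \sum_l B k l * (J i k * J j l - J j k * J i l).
  apply: etrans (exterior_chain Cg db bB (dH i) (dH j)) _.
  apply: eq_bigr => k _; apply: eq_bigr => l _.
  by rewrite !gJx.
have DH k l : 'D_(delta_mx 0 k) (H (delta_mx 0 l)) x =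
    t x * 'D_(delta_mx 0 k) (acoef a l) x + 'D_(delta_mx 0 k) t x * acoef a l x.
  by rewrite HE; have [_ ->] := is_derive_mul (tD (delta_mx 0 k)) (aD (delta_mx 0 k) l).
have JE : (J *m dform a (G x) *m J^T) i j =
    \sum_k \sum_l B k l * (J i k * J j l - J j k * J i l).
  transitivity (\sum_k \sum_l (B k l - B l k) * (J i k * J j l)).
    rewrite exchange_big mxE; apply: eq_bigr => l _; rewrite [J^T _ _]mxE.
    rewrite [(J *m _) _ _]mxE mulr_suml; apply: eq_bigr => k _.
    by rewrite [dform _ _ _ _]mxE [B k l]mxE [B l k]mxE; ring.
  transitivity (\sum_k \sum_l B k l * (J i k * J j l)
      - \sum_k \sum_l B l k * (J i k * J j l)).
    rewrite -sumrB; apply: eq_bigr => k _; rewrite -sumrB; apply: eq_bigr => l _.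
    by rewrite mulrBl.
  rewrite [X in _ - X]exchange_big -sumrB; apply: eq_bigr => k _; rewrite -sumrB.
  by apply: eq_bigr => l _; rewrite mulrBr [X in _ - _ * X]mulrC.
rewrite JE -EC !DH; clear.
have aE k : covec a (tor_proj N x) k 0 = acoef a k x by [].
have dtE k : dt x k 0 = 'D_(delta_mx 0 k) t x by rewrite mxE.
have mE (u v : 'cV[R]_d) : (u *m v^T) i j = u i 0 * v j 0.
  by rewrite mxE big_ord1 mxE.
have entryE (s : R) (X Y Z : 'M[R]_d) : (s *: X + (Y - Z)) i j = s * X i j + (Y i j - Z i j).
  by rewrite !mxE.
rewrite entryE !mE !aE !dtE [dform _ _ _ _]mxE -/(t x).
move: (t x) ('D__ t x) ('D__ t x) (acoef a i x) (acoef a j x).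
move: ('D__ (acoef a j) x) ('D__ (acoef a i) x) => *; ring.
Qed.

(** The matrix at s = 0 of the symplectisation d(e^s a) = e^s (ds /\ a + da). The additional
    dimension turns the contact condition into the invertibility of an antisymmetric matrix. *)
Definition bordered x : 'M[R]_(1 + d) :=
  block_mx 0 (covec a (tor_proj N x))^T (- covec a (tor_proj N x)) (dform a x).

(** By the pullback formula the two bordered matrices are congruent up to the factor tau; its
    exponent is the size of the matrices. *)
Lemma bordered_pullback x :
  \det (bordered (G x)) * \det (tangent F (tor_proj N x)) ^+ 2 =
  tau (tor_proj N x) ^+ d.+1 * \det (bordered x).
Proof.
set J := tangent F _; set av := covec a (tor_proj N x); set s := tau (tor_proj N x).
pose P : 'M[R]_(1 + d) := block_mx 1%:M 0 0 J.
(* E absorbs the term d tau /\ a of d(tau a). *)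
pose E : 'M[R]_(1 + d) := block_mx 1%:M 0 (s^-1 *: dt x) 1%:M.
have Jav : J *m covec a (tor_proj N (G x)) = s *: av by rewrite -FG Fa.
have key : P *m bordered (G x) *m P^T = s *: (E *m bordered x *m E^T).
  rewrite /P /E /bordered !tr_block_mx !mulmx_block !trmx1 !trmx0.
  rewrite !(mul1mx, mulmx1, mul0mx, mulmx0, add0r, addr0).
  rewrite mulmxN Jav scale_block_mx scaler0; congr block_mx.
  - by rewrite -trmx_mul Jav linearZ.
  - by rewrite scalerN.
  - rewrite pullback_dform -/J -/s -/av linearZ /= mulNmx -scalemxAr -scalemxAl.
    have s0 : s != 0 by exact: tau_neq0.
    rewrite !scalerDr scalerN !scalerA mulfV // !scale1r.
    by rewrite addrA [RHS]addrC; congr (_ - _); exact: addrC.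
have detP : \det P = \det J by rewrite det_lblock det1 mul1r.
have detE : \det E = 1 by rewrite det_lblock !det1 mul1r.
move: P E (bordered (G x)) (bordered x) detP detE key => P E K1 K2 detP detE key.
have := congr1 determinant key.
rewrite detZ !det_mulmx !det_tr detP detE mul1r mulr1 => H.
apply: etrans H; by rewrite expr2 mulrA [_ * \det K1]mulrC.
Qed.

End PullbackForm.

Section ContactSymplectic.
Context {R : realType}.

Lemma contact_bordered (N : toral R) (a : N -> 'M[R]_(1, tor_dim N) -> R) x :
  contact_form a -> \det (bordered a x) != 0.
Proof.
move=> [aF [n dn aC]]; have [A A0] := aC (tor_proj N x).
apply: contact_bordered_det A0.
- by rewrite dn mulnC addnC.
- exact: covecE.
- exact: dform_tr.
- by move=> B; rewrite (ext_dE aF) (periodic_base_pt x (@zperiodic_dform _ N a)).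
Qed.

Lemma symplectic_matrix (M : toral R) (f : M -> M) : symplectic f ->
  exists W : M -> 'M[R]_(tor_dim M), [/\ forall i j, smooth (fun q => W q i j),
    forall q, \det (W q) != 0 &
    forall q, tangent f q *m W (f q) *m (tangent f q)^T = W q].
Proof.
move=> [w [[wM wA wS] wd wN] fw].
pose W q : 'M[R]_(tor_dim M) :=
  \matrix_(i, j) w q (col_mx (delta_mx 0 i : 'rV_(tor_dim M)) (delta_mx 0 j : 'rV_(tor_dim M))).
have rU (u v : 'rV[R]_(tor_dim M)) : @row R 2 _ (lshift 1 (0 : 'I_1)) (col_mx u v) = u.
  by apply: etrans (rowKu (0 : 'I_1) u v) _; exact: row_id.
have rD (u v : 'rV[R]_(tor_dim M)) : @row R 2 _ (rshift 1 (0 : 'I_1)) (col_mx u v) = v.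
  by apply: etrans (rowKd (0 : 'I_1) u v) _; exact: row_id.
have wl q (b c : R) (u u' v : 'rV[R]_(tor_dim M)) : w q (col_mx (b *: u + c *: u') v) =
    b * w q (col_mx u v) + c * w q (col_mx u' v).
  apply: ((multilinearP (w q)).1 (wM q) (col_mx (b *: u + c *: u') v) (col_mx u v)
    (col_mx u' v) (lshift 1 (0 : 'I_1)) b c).
  - by rewrite !rU.
  - by move=> j; case: (@split_ordP 1 1 j) => k ->; rewrite (ord1 k) ?eqxx // !rD.
  - by move=> j; case: (@split_ordP 1 1 j) => k ->; rewrite (ord1 k) ?eqxx // !rD.
have wr q (b c : R) (u u' v : 'rV[R]_(tor_dim M)) : w q (col_mx v (b *: u + c *: u')) =
    b * w q (col_mx v u) + c * w q (col_mx v u').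
  apply: ((multilinearP (w q)).1 (wM q) (col_mx v (b *: u + c *: u')) (col_mx v u)
    (col_mx v u') (rshift 1 (0 : 'I_1)) b c).
  - by rewrite !rD.
  - by move=> j; case: (@split_ordP 1 1 j) => k ->; rewrite (ord1 k) ?eqxx // !rU.
  - by move=> j; case: (@split_ordP 1 1 j) => k ->; rewrite (ord1 k) ?eqxx // !rU.
have wE q (u v : 'rV[R]_(tor_dim M)) : w q (col_mx u v) = (u *m W q *m v^T) 0 0.
  have sumE (u' : 'rV[R]_(tor_dim M)) (P : 'rV[R]_(tor_dim M) -> R) :
      (forall b c u1 u2, P (b *: u1 + c *: u2) = b * P u1 + c * P u2) ->
      P u' = \sum_i u' 0 i * P (delta_mx 0 i).
    move=> Pl; rewrite {1}[u']row_sum_delta.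
    elim/big_ind2: _ => [|s1 t1 s2 t2 <- <-|k _].
    - by have := Pl 0 0 0 0; rewrite !scale0r !mul0r !addr0.
    - by have := Pl 1 1 t1 t2; rewrite !scale1r !mul1r.
    - by have := Pl (u' 0 k) 0 (delta_mx 0 k) 0; rewrite scale0r mul0r !addr0.
  rewrite (sumE v (fun v => w q (col_mx u v))) => [|b c u1 u2]; last exact: wr.
  rewrite mxE; apply: eq_bigr => j _; rewrite [v^T _ _]mxE mulrC; congr (_ * _).
  rewrite (sumE u (fun u => w q (col_mx u (delta_mx 0 j)))) => [|b c u1 u2]; last exact: wl.
  by rewrite mxE; apply: eq_bigr => i _; rewrite [W q _ _]mxE.
exists W; split=> [i j|q|q].
- by have := wS (col_mx (delta_mx 0 i : 'rV_(tor_dim M)) (delta_mx 0 j : 'rV_(tor_dim M)));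
    congr smooth; apply/funext => q; rewrite mxE.
- apply/det0P => -[u u0 uW]; have [v] := wN q u u0.
  by rewrite wE uW mul0mx mxE eqxx.
have entryE (A : 'M[R]_(tor_dim M)) i j :
    A i j = ((delta_mx 0 i : 'rV_(tor_dim M)) *m A *m (delta_mx 0 j : 'rV_(tor_dim M))^T) 0 0.
  by rewrite -rowE trmx_delta -colE !mxE.
apply/matrixP => i j; set T := tangent f q.
transitivity (w (f q) (col_mx ((delta_mx 0 i : 'rV_(tor_dim M)) *m T)
    ((delta_mx 0 j : 'rV_(tor_dim M)) *m T))).
  by rewrite wE entryE trmx_mul !mulmxA.
rewrite [RHS]mxE -(fw q) /pullback; apply: (congr1 (w (f q))).
exact: esym (@mul_col_mx R 1 1 _ _ _ _ _).
Qed.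

End ContactSymplectic.

(** * Contact forms invariant under skew-products *)

Lemma derive_const_dir (R : realType) (U W : normedModType R) (h : U -> W) x v :
  (forall t : R, h (t *: v + x) = h x) -> 'D_v h x = 0.
Proof.
move=> hc; rewrite /derive.
have -> : (fun t => t^-1 *: ((h \o shift x) (t *: v) - h x)) = cst 0.
  by apply/funext => t /=; rewrite hc subrr scaler0.
exact: lim_cst.
Qed.

Lemma periodic_family_bounded (R : realType) d (I : finType) (h : I -> 'rV[R]_d -> R^o) :
  (forall i, continuous (h i)) -> (forall i, zperiodic (h i)) ->
  exists D, forall i x, `|h i x| <= D.
Proof.
move=> ch ph.
have [D HD] := choice (fun i => let: ex_intro2 D D0 DP := periodic_bounded (ch i) (@ph i)
  in ex_intro _ D (conj D0 DP)).
exists (\sum_i D i) => i x; apply: le_trans ((HD i).2 x) _.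
by rewrite (bigD1 i) //= lerDl sumr_ge0 // => j _; exact/ltW/(HD j).1.
Qed.

Lemma Ck_bordered (R : realType) (N : toral R) (a : N -> 'M[R]_(1, tor_dim N) -> R) k i j :
  diff_form a -> Ck k (fun x => bordered a x i j : R^o).
Proof.
move=> aF; rewrite /bordered.
have [[u ->]|[u ->]] : (exists u, i = lshift _ u) \/ (exists u, i = rshift 1 u).
- by case: (split_ordP i) => u ->; [left|right]; exists u.
- have [[v ->]|[v ->]] : (exists v, j = lshift _ v) \/ (exists v, j = rshift 1 v).
  + by case: (split_ordP j) => v ->; [left|right]; exists v.
  + rewrite [X in Ck _ X](_ : _ = fun=> 0); first exact: Ck_cst.
    by apply/funext => x; rewrite block_mxEul mxE.
  + rewrite [X in Ck _ X](_ : _ = acoef a v); first exact: Ck_acoef.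
    by apply/funext => x; rewrite block_mxEur mxE (ord1 u).
have [[v ->]|[v ->]] : (exists v, j = lshift _ v) \/ (exists v, j = rshift 1 v).
- by case: (split_ordP j) => v ->; [left|right]; exists v.
- rewrite [X in Ck _ X](_ : _ = fun x => - acoef a u x).
    by apply: CkN; exact: Ck_acoef.
  by apply/funext => x; rewrite block_mxEdl [LHS]mxE (ord1 v).
rewrite [X in Ck _ X](_ : _ = fun x => dform a x u v : R^o); first exact: Ck_dform.
by apply/funext => x; rewrite block_mxEdr.
Qed.

Section SkewContact.
Context {R : realType} (M : toral R) (f finv : M -> M) (gamma : M -> circle R).
Local Notation N := (prod_toral M (torus_toral R 1)).
Local Notation F := (skew_product f gamma).
Local Notation m := (tor_dim M).
Variables (a : N -> 'M[R]_(1, m + 1) -> R) (tau : N -> R).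
Hypotheses (Cf : C1_map f) (Cfinv : C1_map finv) (Cgamma : C1_map gamma).
Hypotheses (fK : cancel f finv) (finvK : cancel finv f).
Hypotheses (f_anosov : anosov f) (f_symplectic : symplectic f).
Hypotheses (a_contact : contact_form a) (tau_smooth : smooth tau).
Hypothesis tau_gt0 : forall p, 0 < tau p.
Hypothesis Fa : forall p A, pullback F a p A = tau p * a p A.

Let aF : diff_form a := a_contact.1.
(** [au] and [al] are the components in a = au + al dt. *)
Let au p : 'cV[R]_m := usubmx (covec a p : 'cV[R]_(m + 1)).
Let al p : R := (dsubmx (covec a p : 'cV[R]_(m + 1))) 0 0.

Lemma covec_skew p : tangent F p *m covec a (F p) = tau p *: covec a p.
Proof.
apply/colP => j; rewrite [RHS]mxE [covec a p j 0]mxE -Fa /pullback (covecE aF).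
by rewrite -mulmxA -rowE [RHS]mxE.
Qed.

Lemma covec_split p : covec a p = col_mx (au p) (al p)%:M.
Proof. by rewrite -[LHS](@vsubmxK _ m 1) -mx11_scalar. Qed.

Lemma covec_skew_blocks p :
  tangent f p.1 *m au (F p) + al (F p) *: tangent gamma p.1 = tau p *: au p /\
  al (F p) = tau p * al p.
Proof.
have := covec_skew p; rewrite skew_tangent_block // !covec_split.
rewrite mul_block_col scale_col_mx => /eq_col_mx[H1 H2]; split.
  by rewrite -H1 mul_mx_scalar.
move: H2; rewrite mul0mx add0r mul1mx => /matrixP/(_ 0 0).
by rewrite mxE eqxx mulr1n [RHS]mxE mxE eqxx mulr1n.
Qed.

Let Finv (p : M * circle R) : M * circle R := (finv p.1, p.2 - gamma (finv p.1)).

Lemma FinvK : cancel Finv F.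
Proof. by case=> q t; rewrite /skew_product /Finv /= finvK subrK. Qed.

Lemma covec_bounded : exists D, forall p j, `|covec a p j 0| <= D.
Proof.
have [D HD] := periodic_family_bounded (fun j => Ck_continuous (Ck_acoef aF 0 j))
  (fun j => @zperiodic_acoef _ N a j).
by exists D => p j; have [x <-] := tor_surj p; exact: HD.
Qed.

(* k is the quotient of the squared densities of w^n /\ dt and of a /\ da^n. *)
Lemma volume_cocycle : exists (k : N -> R) D, [/\ forall p, k p != 0,
  forall p, `|k p| <= D & forall p, k (F p) * tau p ^+ (m + 1).+1 = k p].
Proof.
have [W [WS W0 fW]] := symplectic_matrix f_symplectic.
pose kf (x : 'rV[R]_(m + 1)) : R^o := \det (W (tor_proj N x).1) / \det (bordered a x).
have b0 (x : 'rV[R]_(m + 1)) : \det (bordered a x) != 0 by exact: (@contact_bordered _ N a x).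
have bP : zperiodic (bordered a).
  by move=> x k kZ; rewrite /bordered (@tor_projD _ N x k kZ) (@zperiodic_dform _ N a x k kZ).
have kfP : zperiodic kf.
  by move=> x k kZ; rewrite /kf (@tor_projD _ N x k kZ) (bP x k kZ).
have WC i j : Ck 0 (fun x : 'rV[R]_(m + 1) => W (tor_proj N x).1 i j : R^o).
  apply: (@CkW _ _ _ 1) => //.
  exact: (@Ck1_lsubmx _ m 1 _ (fun y => W (tor_proj M y) i j : R^o) (WS i j 1%N)).
have kfC : continuous kf.
  apply: (@CkM _ _ 0); first exact: Ck_det.
  by apply: CkV => //; apply: Ck_det => i j; exact: (@Ck_bordered _ N a 0 i j aF).
have [D _ HD] := periodic_bounded kfC kfP.
exists (fun p => kf (base_pt p)), D; split=> [p|p|p].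
- by rewrite mulf_neq0 ?W0 // invr_neq0.
- exact: HD.
have [x <-] := tor_surj p; have [G [GL CG] _] := skew_lift Cf Cgamma.
rewrite [F _]GL !periodic_base_pt //.
have aux (K1 K2 w1 w2 J s : R) : K1 != 0 -> K2 != 0 -> J * w2 * J = w1 ->
    K2 * J ^+ 2 = s * K1 -> w2 / K2 * s = w1 / K1.
  move=> K10 K20 <- E; have -> : s = K2 * J ^+ 2 / K1 by rewrite E mulfK.
  by field; rewrite K10.
have detT : \det (tangent F (tor_proj N x)) = \det (tangent f (tor_proj N x).1).
  by rewrite skew_tangent_block // det_ublock det1 mulr1.
apply: (aux _ _ _ _ (\det (tangent f (tor_proj N x).1)) _ (b0 x) (b0 (G x))).
  rewrite -GL -(fW (tor_proj N x).1) !det_mulmx det_tr.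
  by [].
rewrite -detT.
exact: (bordered_pullback aF GL CG tau_smooth (fun p => lt0r_neq0 (tau_gt0 p)) covec_skew x).
Qed.

Lemma au_eq0 p : al p = 0 -> au p = 0.
Proof.
have [k [D1 [k0 HD1 kF]]] := volume_cocycle.
have [D2 HD2] := covec_bounded.
(* The zero set of [al] is F-invariant because tau does not vanish. Extension by 0 outside it
   destroys continuity, but only invariance and boundedness are required. *)
pose th p := if al p == 0 then au p else 0.
have thF p' : th (F p') = if al p' == 0 then au (F p') else 0.
  by rewrite /th (covec_skew_blocks p').2 mulf_eq0 gt_eqF.
move=> al0; suff : th p = 0 by rewrite /th al0 eqxx.
(* The power e + 1 = m + 2 is the exponent of tau in [volume_cocycle], so the factor gained by the
   covector cancels the one lost by [k]. *)
apply: (anosov_covector_eq0 (e := m + 1) (D1 := D1) (D2 := D2) Cf Cfinv fK finvK f_anosov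
  FinvK (pr := fst) (k := k)) => //.
  move=> t v; rewrite thF /th; case: eqP => [alt|_]; last first.
    by rewrite !mulmx0 [(0 : 'M[R]_1) _ _]mxE expr0n !mulr0.
  have := (covec_skew_blocks t).1; rewrite (covec_skew_blocks t).2 alt mulr0 scale0r addr0.
  rewrite -mulmxA => ->; rewrite -scalemxAr [X in _ * X ^+ _ = _]mxE exprMn mulrA kF //.
move=> t j; rewrite /th; case: eqP => _.
  have -> : au t j 0 = covec a t (lshift 1 j) 0 by rewrite mxE.
  exact: HD2.
by rewrite [(0 : 'cV[R]_m) _ _]mxE normr0; exact: le_trans (normr_ge0 _) (HD2 t (lshift 1 j)).
Qed.

Lemma al_neq0 p : al p != 0.
Proof.
apply/eqP => al0; have [x xp] := tor_surj p.
have := contact_bordered x a_contact; rewrite /bordered xp covec_split al0 (au_eq0 al0).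
by rewrite raddf0 col_mx0 oppr0 trmx0 det_lblock det0 // mul0r eqxx.
Qed.

(* a / a(d/dt) = dt + lam is F-invariant. *)
Let lam p : 'cV[R]_m := (al p)^-1 *: au p.

(** Numerator and denominator of [lam] are multiplied by the same tau, which drops out; the term in
    gamma comes from [F]^* dt = dt + dgamma. *)
Lemma lam_skew p : tangent f p.1 *m lam (F p) + tangent gamma p.1 = lam p.
Proof.
have [E1 E2] := covec_skew_blocks p; have t0 := lt0r_neq0 (tau_gt0 p).
rewrite /lam -[au p](scalerK t0) -E1 E2 -scalemxAr !scalerDr !scalerA.
rewrite -invfM (mulrC (al p)); congr (_ + _).
by rewrite mulVf ?scale1r // mulf_neq0 // al_neq0.
Qed.

Let acL : 'I_(m + 1) := rshift m (ord0 : 'I_1).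

Lemma acoef_last (x : 'rV[R]_(m + 1)) : acoef a acL x = al (tor_proj N x).
Proof. by rewrite /acoef /al [RHS]mxE. Qed.

Lemma acoef_last_neq0 (x : 'rV[R]_(m + 1)) : acoef a acL x != 0.
Proof. by rewrite acoef_last al_neq0. Qed.

Let L (j : 'I_m) (x : 'rV[R]_(m + 1)) : R^o := acoef a (lshift 1 j) x / acoef a acL x.

Lemma lamE j (x : 'rV[R]_(m + 1)) : lam (tor_proj N x) j 0 = L j x.
Proof. by rewrite /lam mxE [au _ _ _]mxE /L acoef_last mulrC. Qed.

Lemma Ck_L k j : Ck k (L j).
Proof.
apply: CkM; first exact: (@Ck_acoef _ N a aF).
by apply: CkV; [exact: acoef_last_neq0|exact: (@Ck_acoef _ N a aF)].
Qed.

Lemma zperiodic_L j : zperiodic (L j).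
Proof.
by move=> x k kZ; rewrite /L !(@zperiodic_acoef _ N a _ x k kZ).
Qed.

Lemma lam_translate p s : lam (p.1, p.2 + s) = lam p.
Proof.
pose S (q : M * circle R) : M * circle R := (q.1, q.2 + s).
have [D HD] := periodic_family_bounded (fun j => Ck_continuous (Ck_L 0 j)) zperiodic_L.
have lamD q j : `|lam q j 0| <= D.
  by have [x <-] := tor_surj (q : N); rewrite lamE.
apply/eqP; rewrite -subr_eq0; apply/eqP.
pose th q := lam (S q) - lam q.
(* Translations along the circle commute with [F], and gamma depends on the base point only, so its
   contributions cancel in [th]. The invariance is then exact, whence weight 1 and exponent 1. *)
have SF q : F (S q) = S (F q) by rewrite /S /skew_product /= addrAC.
apply: (anosov_covector_eq0 (T := M * circle R) (e := 0) (D1 := 1) (D2 := D + D)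
  (th := th) (pr := fst) (k := fun=> 1) Cf Cfinv fK finvK f_anosov FinvK
  _ _ _ _ _ p) => //.
- move=> q v; rewrite !expr1 !mul1r /th -SF -(lam_skew (S q)) -(lam_skew q) /=.
  by rewrite opprD addrACA subrr addr0 -mulmxBr mulmxA.
- by move=> _; rewrite normr1.
move=> q j; rewrite /th mxE (le_trans (ler_normD _ _)) // lerD // mxE normrN.
exact: lamD.
Qed.

Lemma derive_L_last j x : 'D_(delta_mx 0 acL) (L j) x = 0.
Proof.
apply: derive_const_dir => t; rewrite -!lamE.
pose s := torus_proj (rsubmx (t *: delta_mx 0 acL : 'rV[R]_(m + 1))).
suff -> : tor_proj N (t *: delta_mx 0 acL + x) =
    ((tor_proj N x).1, (tor_proj N x).2 + s) :> M * circle R.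
  by rewrite lam_translate.
rewrite /= /prod_proj; congr (_, _).
  congr (tor_proj M _); apply/rowP => i; rewrite !mxE.
  by rewrite eq_lrshift andbF mulr0 add0r.
rewrite /s -torus_projD; congr torus_proj.
by apply/rowP => i; rewrite !mxE addrC.
Qed.

Lemma skew_not_contact : (0 < m)%N -> False.
Proof.
move=> m0; apply: (@exact_degenerate R (m + 1) m (lshift 1) L) => //.
- by move=> j; exact: Ck_L.
- exact: zperiodic_L.
(* A kernel vector of d lam on the base is to be lifted to a kernel vector of the bordered matrix,
   against the contact condition. *)
move=> x; set Om := (X in \det X); apply/det0P => -[w w0 wOm].
have /det0P := contact_bordered x a_contact; apply.
pose A := acoef a acL x.
pose dA : 'cV[R]_(m + 1) := \col_i 'D_(delta_mx 0 i) (acoef a acL) x.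
pose be : 'cV[R]_(m + 1) := col_mx (lam (tor_proj N x)) 1%:M.
have A0 : A != 0 by exact: acoef_last_neq0.
have covE : covec a (tor_proj N x) = A *: be.
  rewrite covec_split /be scale_col_mx /A acoef_last /lam scalerA mulfV ?al_neq0 //.
  by rewrite scale1r scale_scalar_mx mulr1.
have acE j : acoef a (lshift 1 j) = fun y => acoef a acL y * L j y : R^o.
  by apply/funext => y; rewrite /L mulrC divfK // acoef_last_neq0.
have LD (v : 'rV[R]_(m + 1)) j : is_derive x v (L j) ('D_v (L j) x).
  by apply: derivableP; apply: diff_derivable; have [+ _] := Ck_L 1 j; exact.
have AD (v : 'rV[R]_(m + 1)) : is_derive x v (acoef a acL) ('D_v (acoef a acL) x).
  by apply: derivableP; apply: diff_derivable; exact: (@differentiable_acoef _ N a aF).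
have Dac v j : 'D_v (acoef a (lshift 1 j)) x = A * 'D_v (L j) x + 'D_v (acoef a acL) x * L j x.
  by rewrite acE; have [_ ->] := is_derive_mul (AD v) (LD v j).
have beL j : be (lshift 1 j) 0 = L j x by rewrite col_mxEu lamE.
have beR : be acL 0 = 1 by rewrite col_mxEd mxE eqxx.
have dAE i : dA i 0 = 'D_(delta_mx 0 i) (acoef a acL) x by rewrite mxE.
have aux1 (b p q r t l l' : R) :
    b * p + r * l' - (b * q + t * l) = b * (p - q) + (r * l' - l * t) by ring.
have aux2 (b r t l : R) : r - (b * 0 + t * l) = b * 0 + (r * 1 - l * t) by ring.
have aux3 (b r t l : R) : b * 0 + t * l - r = b * 0 + (t * l - 1 * r) by ring.
have aux4 (b r : R) : r - r = b * 0 + (r * 1 - 1 * r) by ring.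
(* This is da = A d lam + dA /\ (dt + lam); the zero blocks express that [lam] does not depend on
   the circle coordinate. *)
have dfE : dform a x = A *: block_mx Om 0 0 0 + (dA *m be^T - be *m dA^T).
  apply/matrixP => i j.
  have mE (u v : 'cV[R]_(m + 1)) : (u *m v^T) i j = u i 0 * v j 0.
    by rewrite mxE big_ord1 mxE.
  have entryE (s : R) (P Q T : 'M[R]_(m + 1)) :
      (s *: P + (Q - T)) i j = s * P i j + (Q i j - T i j) by rewrite !mxE.
  rewrite entryE !mE !dAE [LHS]mxE.
  case: (split_ordP i) => i' -> {i mE entryE}; case: (split_ordP j) => j' -> {j}.
  - rewrite block_mxEul !beL !Dac [Om _ _]mxE; exact: aux1.
  - rewrite (ord1 j') -/acL block_mxEur beL beR Dac derive_L_last [_ i' 0]mxE; exact: aux2.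
  - rewrite (ord1 i') -/acL block_mxEdl beL beR Dac derive_L_last [_ 0 j']mxE; exact: aux3.
  rewrite (ord1 i') (ord1 j') -/acL block_mxEdr beR [_ 0 0]mxE; exact: aux4.
(* The lift of [w] to the hyperplane a = 0. Contracting da with it leaves (Y dA) (dt + lam), a
   multiple of a, which the border entry - A^-1 (Y dA) cancels. *)
pose Y : 'rV[R]_(m + 1) := row_mx w (- (w *m lam (tor_proj N x))).
have Ybe : Y *m be = 0.
  by rewrite mul_row_col mulmx1 subrr.
exists (row_mx (- A^-1 *: (Y *m dA)) Y).
  apply: contraNneq w0 => /(congr1 (@rsubmx R 1 1 (m + 1))).
  by rewrite row_mxKr /Y => /(congr1 lsubmx); rewrite row_mxKl !linear0 => ->.
rewrite /bordered mul_row_block mulmx0 add0r covE dfE.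
rewrite mulmxN -scalemxAr Ybe scaler0 oppr0.
have -> : Y *m (A *: block_mx Om 0 0 0 + (dA *m be^T - be *m dA^T)) = Y *m dA *m be^T.
  rewrite mulmxDr -scalemxAr mul_row_block wOm !mulmx0 !addr0 row_mx0 scaler0 add0r.
  by rewrite mulmxBr !mulmxA Ybe mul0mx subr0.
rewrite linearZ /= -scalemxAl -scalemxAr scalerA mulNr mulVf // scaleN1r addNr.
by rewrite row_mx0.
Qed.

End SkewContact.

Theorem theorem1 (R : realType) (n : nat) (hn : (1 <= n)%N)
    (r : regularity) (hr : reg_le (Some 1%N) r)
    (f : torus R (2 * n) -> torus R (2 * n))
    (f_diffeo : diffeo r f) (f_anosov : anosov f) (f_symplectic : symplectic f)
    (gamma : torus R (2 * n) -> circle R) (gamma_Cr : Cr r gamma)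
    (gamma_cob : coboundary r f gamma) :
  ~ ph_contact r (skew_product f gamma).
Proof.
move=> [_ _ [a [tau [a_contact tau_smooth tau_gt0 Fa]]]].
have [finv [fK finvK Cf Cfinv]] := f_diffeo.
apply: (skew_not_contact (Cr_C1_map hr Cf) (Cr_C1_map hr Cfinv) (Cr_C1_map hr gamma_Cr)
  fK finvK f_anosov f_symplectic a_contact tau_smooth tau_gt0 Fa).
by rewrite muln_gt0.
Qed.
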